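(* Fix constants $0<A\le B<\infty$. There exist constants $c_{AB}>0$ and $C_{AB}<\infty$, depending only on $A$ and $B$ (in particular the same constants serve for every dimension $l\ge 1$, including $l=1$), such that the following holds for all integers $l\ge 1$, $N\ge 2$ and $1\le k\le l$, with $d=N^2$. For every $b\in \ell_2^{d,l}$ which generates an $A,B$-Gabor Riesz basis for $\ell_2^{d,l}$, $$c_{AB}\log(N)\ \le\ \|N\Delta_k b\|_{\ell_2^{d,l}}^2+\|N\Delta_k \mathcal{F}_{d,l}(b)\|_{\ell_2^{d,l}}^2 .$$ Conversely, there exists $b\in \ell_2^{d,l}$ which generates an $A,B$-Gabor Riesz basis for $\ell_2^{d,l}$ such that $$\|N\Delta_k b\|_{\ell_2^{d,l}}^2+\|N\Delta_k \mathcal{F}_{d,l}(b)\|_{\ell_2^{d,l}}^2\ \le\ C_{AB}\log(N).$$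
   Context: Here $N\in\mathbb{N}$, $d=N^2$, $\mathbb{Z}_d=\mathbb{Z}/d\mathbb{Z}$, and $\ell_2^{d,l}$ is the space of complex-valued functions $b$ on $\mathbb{Z}_d^l$ with norm $$\|b\|_{\ell_2^{d,l}}^2=\frac{1}{N^l}\sum_{\mathbf{j}\in\mathbb{Z}_d^l}|b(\mathbf{j})|^2 .$$ The discrete Fourier transform is $\mathcal{F}_{d,l}(b)(\mathbf{k})=\frac{1}{N^l}\sum_{\mathbf{j}\in\mathbb{Z}_d^l}b(\mathbf{j})e^{-2\pi i\,\mathbf{j}\cdot\mathbf{k}/d}$, $\mathbf{k}\in\mathbb{Z}_d^l$. For $1\le k\le l$, $\Delta_k b(\mathbf{j})=b(\mathbf{j}+\mathbf{e}_k)-b(\mathbf{j})$, where $\mathbf{e}_k$ is the $k$-th standard basis vector. The discrete Gabor system generated by $b$ is $$G_{d,l}(b)=\{\,b(\mathbf{j}-N\mathbf{n})e^{2\pi i\,\mathbf{j}\cdot\mathbf{m}/N}\,\}_{(\mathbf{n},\mathbf{m})\in\{0,\dots,N-1\}^{2l}}$$ (each element being a function of $\mathbf{j}\in\mathbb{Z}_d^l$). We say $b$ generates an $A,B$-Gabor Riesz basis for $\ell_2^{d,l}$ if $G_{d,l}(b)=\{h_n\}$ is a basis of $\ell_2^{d,l}$ and $A\sum_n|c_n|^2\le\|\sum_n c_nh_n\|_{\ell_2^{d,l}}^2\le B\sum_n|c_n|^2$ for all scalars $(c_n)$. *)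

(* Defs.v *)
From mathcomp Require Import all_boot all_order all_algebra.
From mathcomp Require Import complex.
From mathcomp Require Import reals exp trigo.

Set Implicit Arguments.
Unset Strict Implicit.
Unset Printing Implicit Defensive.

Import Order.TTheory GRing.Theory Num.Theory.

Local Open Scope ring_scope.
Local Open Scope complex_scope.

(* Z_d^l with d = N^2.  Since 'Z_n is the ring of integers mod n only for
   n >= 2, everything below is meaningful for N >= 2 only. *)
Definition torus (N l : nat) := 'rV['Z_(N ^ 2)]_l.

(* R[i]^o is R[i] as a vector space over itself; it makes ell2 R N l a
   finite-dimensional complex vector space (vectType R[i]). *)
Notation ell2 R N l := {ffun torus N l -> R[i]^o}.

Definition ell2_norm (R : realType) (N l : nat) (b : ell2 R N l) : R :=
  Num.sqrt ((N%:R ^+ l)^-1 *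
            \sum_(j : torus N l) ComplexField.Normc.normc (b j) ^+ 2).

(* exp (i t) *)
Definition expi (R : realType) (t : R) : R[i] := cos t +i* sin t.

(* Dot product of the representatives in {0, ..., p-1} and {0, ..., q-1};
   the exponentials below do not depend on the representatives mod d. *)
Definition dotn (p q l : nat) (j : 'rV['I_p]_l) (k : 'rV['I_q]_l) : nat :=
  (\sum_(i < l) j ord0 i * k ord0 i)%N.

Definition DFT (R : realType) (N l : nat) (b : ell2 R N l) : ell2 R N l :=
  [ffun k : torus N l =>
     (N%:R ^+ l)^-1 *
     \sum_(j : torus N l)
        b j * expi (- (2 * pi * (dotn j k)%:R / (N ^ 2)%:R))].

Definition Delta (R : realType) (N l : nat) (k : 'I_l) (b : ell2 R N l) :
    ell2 R N l :=
  [ffun j : torus N l => b (j + delta_mx ord0 k) - b j].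

Definition gabor_index (N l : nat) : finType :=
  ('rV['I_N]_l * 'rV['I_N]_l)%type.

Definition gabor (R : realType) (N l : nat) (b : ell2 R N l)
    (nm : gabor_index N l) : ell2 R N l :=
  [ffun j : torus N l =>
     b (j - \row_(i < l) (N * nm.1 ord0 i)%:R) *
     expi (2 * pi * (dotn j nm.2)%:R / N%:R)].

Definition gabor_riesz_basis (R : realType) (A B : R) (N l : nat)
    (b : ell2 R N l) : Prop :=
  basis_of fullv (codom (gabor b)) /\
  forall c : gabor_index N l -> R[i],
    let sqc := \sum_(nm : gabor_index N l)
                  ComplexField.Normc.normc (c nm) ^+ 2 in
    let s := \sum_(nm : gabor_index N l) c nm *: gabor b nm in
    A * sqc <= ell2_norm s ^+ 2 <= B * sqc.

(* Main.v *)
(** The finite Zak transform W of b, a function on Z_d^l x Z_d^l, diagonalizes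
    the Gabor system: the Riesz basis condition says A <= |W|^2 <= B, and the two
    energies are the squared norms of the differences of W in the first variable
    and of its twisted differences in the second one.  The twist forces W to wind,
    so that at every dyadic scale K <= N/2 a proportion of at least about K^2/d of
    the points sees a difference of step K bounded below.  Since W is bounded, each such
    point has a large second difference at a comparable scale, and by the
    parallelogram law the second difference energies at the scales K = 2^k,
    weighted by K^-2, telescope to the energy at scale 1.  This yields a
    contribution from each of the log N scales.  Conversely, a unimodular W with
    one vortex per cell, tensorized, has energy of order the harmonic sum. *)

Require Import Defs.
From mathcomp Require Import all_boot all_order all_algebra.
From mathcomp Require Import complex.
From mathcomp Require Import reals exp trigo.
From mathcomp Require Import classical_sets topology normedtype derive.
From mathcomp Require Import ring lra zify.

Set Implicit Arguments.
Unset Strict Implicit.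
Unset Printing Implicit Defensive.

Import Order.TTheory GRing.Theory Num.Theory.
Import numFieldTopology.Exports.

Local Open Scope ring_scope.
Local Open Scope complex_scope.

(** * Squared modulus, unit exponentials and arguments of complex numbers *)

Section ComplexNorm.
Variable R : realType.
Implicit Types (z w : R[i]) (s t : R).

Definition nsq z : R := ComplexField.Normc.normc z ^+ 2.

Lemma nsqE z : nsq z = complex.Re z ^+ 2 + complex.Im z ^+ 2.
Proof. by case: z => a b; rewrite /nsq /= sqr_sqrtr ?addr_ge0 ?sqr_ge0. Qed.

Lemma nsq_ge0 z : 0 <= nsq z.
Proof. exact: sqr_ge0. Qed.

Lemma nsqM z w : nsq (z * w) = nsq z * nsq w.
Proof. by rewrite /nsq ComplexField.Normc.normcM exprMn. Qed.

Lemma nsqC z : (nsq z)%:C = z * z^*.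
Proof. by rewrite nsqE add_Re2_Im2 sqr_normc. Qed.

Lemma nsq_real t : nsq t%:C = t ^+ 2.
Proof. by rewrite nsqE /= expr0n addr0. Qed.

Lemma nsq0 : nsq 0 = 0. Proof. by rewrite (nsq_real 0) expr0n. Qed.

Lemma nsq1 : nsq 1 = 1. Proof. by rewrite (nsq_real 1) expr1n. Qed.

Lemma nsqN z : nsq (- z) = nsq z.
Proof. by case: z => a b; rewrite !nsqE /= !sqrrN. Qed.

Lemma nsq_gt0 z : (0 < nsq z) = (z != 0).
Proof.
rewrite lt0r nsq_ge0 andbT /nsq sqrf_eq0; congr (~~ _).
apply/eqP/eqP => [/ComplexField.Normc.eq0_normc //|->].
exact: ComplexField.Normc.normc0.
Qed.

Lemma parallelogram z w : nsq (z + w) + nsq (z - w) = 2 * nsq z + 2 * nsq w.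
Proof. by case: z w => [a b] [c d]; rewrite !nsqE /=; ring. Qed.

Lemma nsqD_le z w : nsq (z + w) <= 2 * nsq z + 2 * nsq w.
Proof. by rewrite -parallelogram lerDl nsq_ge0. Qed.

Lemma expiD s t : expi (s + t) = expi s * expi t.
Proof.
by rewrite /expi cosD sinD; apply/eqP; rewrite eq_complex /= addrC eqxx /=; apply/eqP; ring.
Qed.

Lemma expi0 : expi 0 = 1 :> R[i].
Proof. by rewrite /expi cos0 sin0. Qed.

Lemma expi_neq0 t : expi t != 0.
Proof.
apply/negP => /eqP h; have := expiD t (- t).
by rewrite subrr expi0 h mul0r => /eqP; rewrite oner_eq0.
Qed.

Lemma expiN t : expi (- t) = (expi t)^-1.
Proof. by apply: (mulfI (expi_neq0 t)); rewrite -expiD subrr expi0 mulfV ?expi_neq0. Qed.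

Lemma expi_conj t : (expi t)^* = (expi t)^-1.
Proof. by rewrite -expiN /expi cosN sinN. Qed.

Lemma expiMn t n : expi (t *+ n) = expi t ^+ n.
Proof. by elim: n => [|n IH]; rewrite ?mulr0n ?expi0 // mulrS expiD IH exprS. Qed.

Lemma nsq_expi t : nsq (expi t) = 1.
Proof. by rewrite nsqE /= cos2Dsin2. Qed.

Lemma expi_2pi : expi (2 * pi) = 1 :> R[i].
Proof. by rewrite /expi mulr_natl cos2pi sin2pi. Qed.

Lemma cos_half t : cos t = 2 * cos (t / 2) ^+ 2 - 1.
Proof.
have -> : cos t = cos ((t / 2) *+ 2) by congr cos; rewrite mulr2n; field.
by rewrite cos_mulr2n -mulr_natl.
Qed.

(** The half-angle formula gives sin (|t| / 2) = 0, whereas sin is positive on ]0, pi[. *)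
Lemma expi_eq1 t : expi t = 1 -> `|t| < 2 * pi -> t = 0.
Proof.
move=> [ct st] lt; have pi0 := pi_gt0 R.
have : cos (`|t| / 2) ^+ 2 = 1.
  by have := cos_half `|t|; rewrite cos_norm ct; lra.
move=> c2; have s0 : sin (`|t| / 2) = 0.
  by apply/eqP; rewrite -sqrf_eq0 sin2cos2 c2 subrr.
have [t0|t0] := eqVneq t 0; first by [].
have := @sin_gt0_pi R (`|t| / 2); rewrite s0 ltxx => h.
have : 0 < `|t| by rewrite normr_gt0.
by move=> ?; exfalso; have : false by apply: h; lra.
Qed.

Lemma ge0_sin_le t : 0 <= t -> sin t <= t.
Proof.
move=> t0; have [->|tn0] := eqVneq t 0; first by rewrite sin0.
have tp : 0 < t by rewrite lt0r tn0.
have [c _ ] := @MVT R sin cos 0 t tp (fun x _ => is_derive_sin x)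
  (@continuous_subspaceT _ _ _ _ (@continuous_sin R)).
rewrite sin0 !subr0 => ->; rewrite ler_piMl //; exact: cos_le1.
Qed.

(** A chord is at most its arc: the left side is 4 sin(u)^2 with u = |s - t| / 2. *)
Lemma nsq_expiB s t : nsq (expi s - expi t) <= (s - t) ^+ 2.
Proof.
have u0 : 0 <= `|s - t| / 2 by rewrite divr_ge0.
set u := `|s - t| / 2 in u0.
have -> : nsq (expi s - expi t) = 4 * sin u ^+ 2.
  have h : nsq (expi s - expi t) = 2 - 2 * cos (s - t).
    have := (cos2Dsin2 s, cos2Dsin2 t); rewrite nsqE /= cosB => -[].
    set a := cos s; set b := sin s; set c := cos t; set d := sin t => h1 h2.
    by rewrite -{1}[2]/(1 + 1) -{1}h1 -{1}h2; ring.
  have := cos_half `|s - t|; rewrite cos_norm -/u h => ->.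
  by rewrite sin2cos2; ring.
have -> : (s - t) ^+ 2 = 4 * u ^+ 2.
  by rewrite /u exprMn exprVn -(real_normK (num_real (s - t))) ; field.
rewrite ler_pM2l //.
(* Up to 1 < pi the sine is nonnegative, so sin u <= u can be squared; beyond 1 the bound sin^2 <= 1
   suffices. *)
have [u1|u1] := leP u 1.
  have su : 0 <= sin u by apply: sin_ge0_pi; have := pi_ge2 R; lra.
  by rewrite ler_sqr ?nnegrE // ge0_sin_le.
apply: (@le_trans _ _ 1); last by rewrite exprn_ege1 // ltW.
by rewrite sin2cos2 gerBl sqr_ge0.
Qed.

(** The principal argument, in ]-pi, pi] for nonzero z; it is only used there. *)
Definition arg z : R :=
  let c := acos (complex.Re z / ComplexField.Normc.normc z) in
  if 0 <= complex.Im z then c else - c.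

Lemma normc_ge0 z : 0 <= ComplexField.Normc.normc z.
Proof. by case: z => a b; rewrite sqrtr_ge0. Qed.

Lemma argP z : z != 0 ->
  `|arg z| <= pi /\ z = (ComplexField.Normc.normc z)%:C * expi (arg z).
Proof.
rewrite -nsq_gt0 => z0; set m := ComplexField.Normc.normc z.
have m0 : 0 < m.
  rewrite lt0r normc_ge0 andbT; apply/eqP => m0.
  by move: z0; rewrite /nsq -/m m0 expr0n ltxx.
have zE : complex.Re z ^+ 2 + complex.Im z ^+ 2 = m ^+ 2 by rewrite -nsqE.
set x := complex.Re z / m; set y := complex.Im z / m.
have xy : x ^+ 2 + y ^+ 2 = 1.
  by rewrite !exprMn -mulrDl zE exprVn mulfV // sqrf_eq0 gt_eqF.
have x1 : -1 <= x <= 1.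
  rewrite -ler_norml -(ler_sqr (x := `|x|)) ?nnegrE // real_normK ?num_real //.
  by have := sqr_ge0 y; lra.
have c0 := acos_ge0 x1; have cpi := acos_lepi x1.
have sE : sin (acos x) = `|y|.
  by rewrite sin_acos // -xy addrAC subrr add0r sqrtr_sqr.
have cE : cos (acos x) = x by rewrite acosK.
have zE2 : z = (m * x) +i* (m * y).
  by case: (z) @x @y {x1 c0 cpi sE cE xy zE} => a b /=; rewrite !mulrA ![m * _]mulrC !mulfK ?gt_eqF.
rewrite /arg -/m -/x; case: ifP => sgn; split.
- by rewrite ger0_norm.
- rewrite {1}zE2 /expi sE cE ger0_norm; last by rewrite divr_ge0 // ltW.
  by apply/eqP; rewrite eq_complex /=; apply/andP; split; apply/eqP; ring.
- by rewrite normrN ger0_norm.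
rewrite {1}zE2 /expi sinN cosN sE cE ler0_norm ?opprK.
  by apply/eqP; rewrite eq_complex /=; apply/andP; split; apply/eqP; ring.
by rewrite mulr_le0_ge0 ?invr_ge0 ?ltW // ltNge sgn.
Qed.

(** With m = |z| and a the argument, |z - 1|^2 = m^2 - 2 m cos a + 1. Here cos a <= 3/4, and 2 m <=
    m^2 + 1 leaves a quarter of m^2 + 1. *)
Lemma nsqB1_large_arg z : z != 0 -> pi / 4 <= `|arg z| ->
  (nsq z + 1) / 4 <= nsq (z - 1).
Proof.
move=> z0 h; have [api zE] := argP z0; have pi0 := pi_gt0 R.
set m := ComplexField.Normc.normc z in zE.
move: (arg z) h api zE => a h api zE.
have m0 : 0 <= m by exact: normc_ge0.
have c4 : cos (pi / 4) <= 3 / 4 :> R.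
  have := cos_half (pi / 2 : R); rewrite cos_pihalf.
  have -> : pi / 2 / 2 = pi / 4 :> R by field.
  by move=> h4; nra.
have ca : cos a <= 3 / 4.
  apply: le_trans c4; rewrite -cos_norm leNgt; apply/negP.
  by rewrite ltr_cos ?in_itv /=; lra.
have := cos2Dsin2 a.
rewrite zE nsqM nsq_real nsq_expi nsqE /= !mul0r !subr0 !addr0 mulr1.
set c := cos a in ca *; set s := sin a => h1.
have -> : (m * c - 1) ^+ 2 + (m * s) ^+ 2 = m ^+ 2 * (c ^+ 2 + s ^+ 2) - 2 * m * c + 1 by ring.
rewrite h1; have := sqr_ge0 (m - 1).
have := mulr_ge0 m0 (_ : 0 <= 3 / 4 - c); rewrite subr_ge0 => /(_ ca).
lra.
Qed.

End ComplexNorm.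

(** * First and second differences at dyadic scales on a finite abelian group *)

Section Differences.
Variables (R : realType) (G : finZmodType) (f : G -> R[i]).
Implicit Types (u e : G).

Lemma sum_shift (T : nmodType) (F : G -> T) u : \sum_x F (x + u) = \sum_x F x.
Proof. by rewrite [RHS](reindex_inj (addIr u)). Qed.

Definition dnsq u x := nsq (f (x + u) - f x).

Definition d2nsq u x := nsq (f (x + u + u) - f (x + u) - (f (x + u) - f x)).

(** The parallelogram law for two consecutive steps u: their sum is the step 2u, their difference
    the second difference. *)
Lemma dnsq_double u :
  \sum_x dnsq (u *+ 2) x + \sum_x d2nsq u x = 4 * \sum_x dnsq u x.
Proof.
have -> : 4 * \sum_x dnsq u x =
    \sum_x (2 * dnsq u (x + u) + 2 * dnsq u x).
  rewrite big_split /= -!mulr_sumr (sum_shift (dnsq u)); ring.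
rewrite -big_split; apply: eq_bigr => x _; rewrite -parallelogram; congr (nsq _ + _).
by rewrite mulr2n addrA; ring.
Qed.

Lemma sum_dnsq_expn e k :
  \sum_x dnsq (e *+ 2 ^ k) x <= 4 ^+ k * \sum_x dnsq e x.
Proof.
elim: k => [|k IH]; first by rewrite mul1r expn0 mulr1n.
have := dnsq_double (e *+ 2 ^ k); rewrite -mulrnA -expnSr exprS -mulrA => h.
have := sumr_ge0 (index_enum G) (fun x _ => nsq_ge0 _ : 0 <= d2nsq (e *+ 2 ^ k) x).
by move=> /(_ xpredT) /=; lra.
Qed.

(* By the parallelogram law the sum telescopes. *)
Lemma sum_d2nsq_dyadic e i n :
  \sum_(k < n) 4 ^- k * \sum_x d2nsq (e *+ 2 ^ (k + i)) x
    <= 4 * 4 ^+ i * \sum_x dnsq e x.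
Proof.
suff : \sum_(k < n) 4 ^- k * \sum_x d2nsq (e *+ 2 ^ (k + i)) x =
    4 * \sum_x dnsq (e *+ 2 ^ i) x
    - 4 * 4 ^- n * \sum_x dnsq (e *+ 2 ^ (n + i)) x.
  move=> ->; rewrite -[leRHS]mulrA; apply: (@le_trans _ _ (4 * \sum_x dnsq (e *+ 2 ^ i) x)).
    rewrite gerBl !mulr_ge0 ?invr_ge0 ?exprn_ge0 //.
    by apply: sumr_ge0 => x _; exact: nsq_ge0.
  by rewrite ler_pM2l // sum_dnsq_expn.
elim: n => [|n IH]; first by rewrite big_ord0 expr0 invr1 add0n mulr1 subrr.
rewrite big_ord_recr /= IH; have := dnsq_double (e *+ 2 ^ (n + i)).
rewrite -mulrnA -expnSr addSn exprS => h.
have h4 : (4 : R) ^+ n != 0 by rewrite expf_neq0 ?pnatr_eq0.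
move: h; move: (\sum_x d2nsq _ _) (\sum_x dnsq (e *+ 2 ^ (n + i).+1) x) => a b h.
have -> : a = 4 * (\sum_x dnsq (e *+ 2 ^ (n + i)) x) - b by rewrite -h; ring.
by field.
Qed.

(** Twice a step u is the step 2u minus a second difference, so the square at u is at most half the
    sum of the other two squares. Iterating over r doublings leaves a first difference with weight
    2^-r. *)
Lemma dnsq_le_d2nsq e k r x :
  dnsq (e *+ 2 ^ k) x <= 2 ^- r * dnsq (e *+ 2 ^ (k + r)) x
     + \sum_(i < r) 2 ^- i.+1 * d2nsq (e *+ 2 ^ (k + i)) x.
Proof.
elim: r => [|r IH]; first by rewrite big_ord0 expr0 invr1 mul1r addn0 addr0.
rewrite big_ord_recr /= [X in _ <= _ + X]addrC addrA; apply: (le_trans IH).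
rewrite lerD2r -mulrDr exprSr invfM -mulrA.
rewrite ler_pM2l ?invr_gt0 ?exprn_gt0 // ler_pdivlMl //.
rewrite addnS expnS mulnC mulrnA; set u := e *+ _.
have := nsqD_le (f (x + u *+ 2) - f x) (- (f (x + u + u) - f (x + u) - (f (x + u) - f x))).
rewrite nsqN -/(d2nsq u x) -/(dnsq (u *+ 2) x) mulr2n addrA.
have -> : f (x + u + u) - f x - (f (x + u + u) - f (x + u) - (f (x + u) - f x)) =
  2%:C * (f (x + u) - f x) by rewrite -[2%:C]/(1 + 1)%:C rmorphD /= ; ring.
rewrite nsqM nsq_real -/(dnsq u x); lra.
Qed.

(** Since f is bounded, r doublings make the remaining first difference cost at most delta / 2, so a
    difference of size delta is paid for by second differences at the next r scales. These are
    summed over k by [sum_d2nsq_dyadic]. *)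
Lemma large_differences e (M delta : R) r n :
  (forall x, nsq (f x) <= M) -> 0 < delta -> 8 * M <= delta * 2 ^+ r ->
  \sum_(k < n) 4 ^- k * \sum_x (delta <= dnsq (e *+ 2 ^ k) x)%R%:R
    <= 4 * 2 ^+ r / delta * \sum_x dnsq e x.
Proof.
move=> fM d0 Mr.
have bad k x : (delta <= dnsq (e *+ 2 ^ k) x)%R%:R <=
    2 / delta * \sum_(i < r) 2 ^- i.+1 * d2nsq (e *+ 2 ^ (k + i)) x.
  have s0 : 0 <= \sum_(i < r) 2 ^- i.+1 * d2nsq (e *+ 2 ^ (k + i)) x.
    by apply: sumr_ge0 => i _; rewrite mulr_ge0 ?nsq_ge0 // invr_ge0 exprn_ge0.
  have [h|_] := leP delta; last by rewrite /= mulr0n mulr_ge0 // divr_ge0 // ltW.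
  rewrite /= mulr1n mulrAC ler_pdivlMr // mul1r.
  have := le_trans h (dnsq_le_d2nsq e k r x).
  (* Any first difference has square at most 4 M, and 8 M <= delta * 2^r. *)
  have : 2 ^- r * dnsq (e *+ 2 ^ (k + r)) x <= delta / 2.
    rewrite mulrC ler_pdivrMr ?exprn_gt0 //.
    apply: (@le_trans _ _ (4 * M)); last by lra.
    apply: le_trans (nsqD_le _ _) _; rewrite nsqN.
    by have := fM x; have := fM (x + e *+ 2 ^ (k + r)); lra.
  lra.
apply: (@le_trans _ _ (\sum_(k < n) 4 ^- k * \sum_x
   (2 / delta * \sum_(i < r) 2 ^- i.+1 * d2nsq (e *+ 2 ^ (k + i)) x))).
  apply: ler_sum => k _; rewrite ler_pM2l ?invr_gt0 ?exprn_gt0 //.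
  by apply: ler_sum => x _.
have -> : \sum_(k < n) 4 ^- k * \sum_x
   (2 / delta * \sum_(i < r) 2 ^- i.+1 * d2nsq (e *+ 2 ^ (k + i)) x) =
   2 / delta * \sum_(i < r) 2 ^- i.+1 * \sum_(k < n) 4 ^- k * \sum_x d2nsq (e *+ 2 ^ (k + i)) x.
  under eq_bigr => k _ do rewrite -mulr_sumr exchange_big /= mulrCA mulr_sumr.
  rewrite -mulr_sumr exchange_big /=; congr (_ * _); apply: eq_bigr => i _.
  rewrite mulr_sumr; apply: eq_bigr => k _.
  by rewrite mulrCA; congr (_ * _); rewrite mulr_sumr.
have -> : 4 * 2 ^+ r / delta * \sum_x dnsq e x = 2 / delta * (2 * 2 ^+ r * \sum_x dnsq e x) by ring.
rewrite ler_pM2l ?divr_gt0 //.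
have E0 : 0 <= \sum_x dnsq e x by apply: sumr_ge0 => x _; exact: nsq_ge0.
(* The weight 2^-(i+1) times the bound 4 * 4^i of the telescoped sum is 2 * 2^i, whose sum over i <
   r is below 2 * 2^r. *)
apply: (@le_trans _ _ (\sum_(i < r) 2 * 2 ^+ i * \sum_x dnsq e x)).
  apply: ler_sum => i _.
  apply: (@le_trans _ _ (2 ^- i.+1 * (4 * 4 ^+ i * \sum_x dnsq e x))).
    by rewrite ler_pM2l ?invr_gt0 ?exprn_gt0 // sum_d2nsq_dyadic.
  have -> : 4 ^+ i = 2 ^+ i * 2 ^+ i :> R by rewrite -exprMn -natrM.
  rewrite !mulrA ler_wpM2r // exprS.
  by rewrite le_eqVlt; apply/orP; left; apply/eqP; field; rewrite expf_neq0 ?pnatr_eq0.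
rewrite -mulr_suml ler_wpM2r // -mulr_sumr ler_pM2l //.
elim: (r) => [|m IH]; first by rewrite big_ord0.
by rewrite big_ord_recr /= exprS; lra.
Qed.

End Differences.

(** * Winding forces large differences at every dyadic scale *)

Section Vortex.
Variable R : realType.
Implicit Types (z w : R[i]).

Lemma ler_bool (b b' : bool) : (b -> b') -> b%:R <= b'%:R :> R.
Proof. by case: b; case: b' => // /(_ isT). Qed.

Lemma expi_arg z : z != 0 -> expi (arg z) = z / (ComplexField.Normc.normc z)%:C.
Proof.
move=> z0; have [_ zE] := argP z0; rewrite {2}zE mulrC mulKf //.
by apply/eqP => -[/ComplexField.Normc.eq0_normc /eqP]; apply/negP.
Qed.

Lemma expi_argM z w : z != 0 -> w != 0 ->
  expi (arg (z * w)) = expi (arg z) * expi (arg w).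
Proof.
move=> z0 w0; rewrite !expi_arg ?mulf_neq0 // ComplexField.Normc.normcM rmorphM.
by rewrite invfM mulrACA.
Qed.

Lemma expi_arg_unit z : nsq z = 1 -> expi (arg z) = z.
Proof.
move=> z1; rewrite expi_arg -?nsq_gt0 ?z1 ?ltr01 //.
have -> : ComplexField.Normc.normc z = 1; last by rewrite invr1 mulr1.
by apply/eqP; rewrite -(@eqrXn2 _ 2) ?normc_ge0 // -/(nsq z) z1 expr1n.
Qed.

(** Arguments add only modulo 2 pi. Under [expi] they become z / |z|, which is multiplicative, so
    the relation survives. *)
Lemma expi_arg_prod z1 z2 z3 z4 (t : R) : z1 != 0 -> z2 != 0 -> z3 != 0 ->
  z4 != 0 -> z1 * z2 = z3 * z4 * expi t ->
  expi (arg z1) * expi (arg z2) = expi (arg z3) * expi (arg z4) * expi t.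
Proof.
move=> z10 z20 z30 z40 h.
by rewrite -!expi_argM // h expi_argM ?mulf_neq0 ?expi_neq0 // (expi_arg_unit (nsq_expi t)).
Qed.

(** Multiplying [nsqB1_large_arg] for w / z by |z|^2 gives |w - z|^2 >= (|w|^2 + |z|^2) / 4. *)
Lemma large_arg_quotient (A : R) z w : 0 < A -> A <= nsq z -> A <= nsq w ->
  pi / 4 <= `|arg (w / z)| -> A / 2 <= nsq (w - z).
Proof.
move=> A0 zA wA h; have z0 : z != 0 by rewrite -nsq_gt0 (lt_le_trans A0).
have w0 : w != 0 by rewrite -nsq_gt0 (lt_le_trans A0).
have := nsqB1_large_arg (mulf_neq0 w0 (invr_neq0 z0)) h.
have -> : w - z = z * (w / z - 1) by field.
have wE : nsq w = nsq z * nsq (w / z) by rewrite -nsqM mulrC mulfVK.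
rewrite [nsq (_ * (_ - _))]nsqM => h1.
have : nsq z * ((nsq (w / z) + 1) / 4) <= nsq z * nsq (w / z - 1).
  by rewrite ler_pM2l // (lt_le_trans A0).
by rewrite mulrA mulrDr -wE; lra.
Qed.

(* The plaquette sums add up to theta times the number of plaquettes because
   the angles telescope, and a plaquette with four small angles sums to 0. *)
Lemma count_vortices (G : finZmodType) (u : G) (theta : R) (ax ay : G -> G -> R) :
  0 <= theta <= pi / 2 ->
  (forall m n, `|ax m n| <= pi) -> (forall m n, `|ay m n| <= pi) ->
  (forall m n,
    expi (ax m n + ay (m + u) n - ax m (n + u) - ay m n + theta) = 1) ->
  theta * #|G|%:R ^+ 2 <= 10 * pi *
    (\sum_n \sum_m (pi / 4 <= `|ax m n|)%R%:R +
     \sum_m \sum_n (pi / 4 <= `|ay m n|)%R%:R).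
Proof.
move=> /andP[t0 t1] ax1 ay1 flat; have pi0 := pi_gt0 R.
set w := fun m n => ax m n + ay (m + u) n - ax m (n + u) - ay m n + theta.
pose bX m n : R := (pi / 4 <= `|ax m n|)%R%:R.
pose bY m n : R := (pi / 4 <= `|ay m n|)%R%:R.
(* Always w <= 4 pi + pi / 2, which suffices once one angle is large. If all four are small then |w|
   < pi + pi / 2 < 2 pi, and [flat] forces w = 0. *)
have wb m n : w m n <= 5 * pi * (bX m n + bX m (n + u) + bY m n + bY (m + u) n).
  have b0 (b : bool) : 0 <= b%:R :> R by rewrite ler0n.
  move: (ax1 m n) (ax1 m (n + u)) (ay1 m n) (ay1 (m + u) n).
  rewrite !ler_norml => /andP[? ?] /andP[? ?] /andP[? ?] /andP[? ?].
  have wle : w m n <= 5 * pi by rewrite /w; lra.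
  have [s1|s1] := leP 1 (bX m n + bX m (n + u) + bY m n + bY (m + u) n).
    by apply: (le_trans wle); rewrite ler_peMr // mulr_ge0 // ltW.
  have -> : w m n = 0.
    apply: expi_eq1; first exact: flat.
    have small (c : R) : (pi / 4 <= `|c|)%R%:R < 1 :> R -> - (pi / 4) < c < pi / 4.
      by have [_|h _] := leP (pi / 4) `|c|; rewrite ?ltxx // -ltr_norml.
    have [/small/andP[? ?] /small/andP[? ?] /small/andP[? ?] /small/andP[? ?]] :
        [/\ bX m n < 1, bX m (n + u) < 1, bY m n < 1 & bY (m + u) n < 1].
      move: (b0 (pi / 4 <= `|ax m n|)) (b0 (pi / 4 <= `|ax m (n + u)|))
        (b0 (pi / 4 <= `|ay m n|)) (b0 (pi / 4 <= `|ay (m + u) n|)) s1.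
      by rewrite /bX /bY; split; lra.
    by rewrite ltr_norml /w; lra.
  apply: mulr_ge0; first by rewrite mulr_ge0 // ltW.
  by rewrite !addr_ge0 //; exact: b0.
have -> : theta * #|G|%:R ^+ 2 = \sum_m \sum_n w m n.
  have -> : \sum_m \sum_n w m n = \sum_m \sum_n ax m n + \sum_m \sum_n ay (m + u) n
      - \sum_m \sum_n ax m (n + u) - \sum_m \sum_n ay m n + \sum_(m : G) \sum_(n : G) theta.
    rewrite -big_split -sumrB -sumrB -big_split; apply: eq_bigr => m _ /=.
    by rewrite -big_split -sumrB -sumrB -big_split.
  rewrite (sum_shift (fun m => \sum_n ay m n)).
  under [X in _ - X - _ + _]eq_bigr => m _ do rewrite (sum_shift (ax m)).
  rewrite !sumr_const; set a := \sum_m _; set b := \sum_m _.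
  rewrite -mulrnA -[theta *+ _]mulr_natr natrM -expr2.
  by move: (_ * _ ^+ 2) => t; ring.
apply: (@le_trans _ _ (\sum_m \sum_n 5 * pi * (bX m n + bX m (n + u) + bY m n + bY (m + u) n))).
  by apply: ler_sum => m _; apply: ler_sum => n _.
(* Both sides agree: each edge borders two plaquettes, which turns 5 pi into 10 pi. *)
rewrite le_eqVlt; apply/orP; left; apply/eqP.
rewrite [\sum_n \sum_m _]exchange_big /=.
under eq_bigr => m _ do rewrite -mulr_sumr.
rewrite -mulr_sumr.
have -> : \sum_m \sum_n (bX m n + bX m (n + u) + bY m n + bY (m + u) n) =
  \sum_m \sum_n bX m n + \sum_m \sum_n bX m (n + u) + \sum_m \sum_n bY m n +
  \sum_m \sum_n bY (m + u) n.
  rewrite -!big_split; apply: eq_bigr => m _ /=.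
  by rewrite -!big_split.
rewrite (sum_shift (fun m => \sum_n bY m n)).
under [X in _ + X + _ + _]eq_bigr => m _ do rewrite (sum_shift (bX m)).
by rewrite /bX /bY; ring.
Qed.

(* A step e in the first variable changes the phase c of a step in the second
   one by tau: this is the curvature that forces the winding. *)
Section Twist.
Variables (G : finZmodType) (e : G) (tau A B : R).
Variables (W g : G -> G -> R[i]) (c : G -> R[i]).
Hypotheses (tau0 : 0 <= tau) (A0 : 0 < A).
Hypothesis W_bounds : forall m n, A <= nsq (W m n) <= B.
Hypothesis g1 : forall m n, nsq (g m n) = 1.
Hypothesis gS : forall m n, g m (n + e) = g m n * c m.
Hypothesis cS : forall m, c (m + e) = c m * expi (- tau).

(** The gauge factor g turns twisted differences into plain ones: V m (n + e) - V m n is g m n times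
    c m * W m (n + e) - W m n. *)
Let V m n := g m n * W m n.

(** Around a square of side K e the phases fail to close up by K^2 tau: K steps in n produce c^K,
    and K steps in m change c^K by the angle - K^2 tau. So [count_vortices] applies to the arguments
    of the edge quotients. *)
Lemma twisted_large_differences (K : nat) : K%:R ^+ 2 * tau <= pi / 2 ->
  K%:R ^+ 2 * tau * #|G|%:R ^+ 2 <= 10 * pi *
    (\sum_n \sum_m (A / 2 <= dnsq (W^~ n) (e *+ K) m)%R%:R +
     \sum_m \sum_n (A / 2 <= dnsq (V m) (e *+ K) n)%R%:R).
Proof.
move=> Kt; set u := e *+ K.
have WA m n : A <= nsq (W m n) by have /andP[] := W_bounds m n.
have W0 m n : W m n != 0 by rewrite -nsq_gt0 (lt_le_trans A0).
have g0 m n : g m n != 0 by rewrite -nsq_gt0 g1.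
have V0 m n : V m n != 0 by rewrite mulf_neq0.
have VA m n : A <= nsq (V m n) by rewrite nsqM g1 mul1r.
have gK m n : g m (n + u) = g m n * c m ^+ K.
  rewrite /u; elim: (K) => [|k IH]; first by rewrite mulr0n addr0 mulr1.
  by rewrite mulrSr addrA gS IH exprSr mulrA.
have cK m : c (m + u) = c m * expi (- tau) ^+ K.
  rewrite /u; elim: (K) => [|k IH]; first by rewrite mulr0n addr0 mulr1.
  by rewrite mulrSr addrA cS IH exprSr mulrA.
pose ax m n := arg (W (m + u) n / W m n).
pose ay m n := arg (V m (n + u) / V m n).
have flat m n :
    expi (ax m n + ay (m + u) n - ax m (n + u) - ay m n + K%:R ^+ 2 * tau) = 1.
  have VE m' : V m' (n + u) / V m' n = c m' ^+ K * (W m' (n + u) / W m' n).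
    by rewrite /V gK; field; rewrite W0 g0.
  have zE : (W (m + u) n / W m n) * (V (m + u) (n + u) / V (m + u) n) =
     (W (m + u) (n + u) / W m (n + u)) * (V m (n + u) / V m n) * expi (- (K%:R ^+ 2 * tau)).
    rewrite !VE cK exprMn -exprM -expiMn.
    have -> : - tau *+ (K * K) = - (K%:R ^+ 2 * tau).
      by rewrite -[LHS]mulr_natl natrM mulrN -expr2.
    by field; rewrite !W0.
  have := expi_arg_prod _ _ _ _ zE; rewrite !mulf_neq0 ?invr_eq0 // => /(_ isT isT isT isT) h.
  rewrite !expiD h !expiN; field.
  by rewrite !expi_neq0.
have pi0 := pi_gt0 R.
have axpi m n : `|ax m n| <= pi.
  by case: (@argP R (W (m + u) n / W m n)); rewrite ?mulf_neq0 ?invr_eq0.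
have aypi m n : `|ay m n| <= pi.
  by case: (@argP R (V m (n + u) / V m n)); rewrite ?mulf_neq0 ?invr_eq0.
have Kt0 : 0 <= K%:R ^+ 2 * tau <= pi / 2 by rewrite Kt andbT mulr_ge0 ?exprn_ge0.
apply: (le_trans (count_vortices Kt0 axpi aypi flat)).
rewrite ler_pM2l ?mulr_gt0 //; apply: lerD; apply: ler_sum => x _; apply: ler_sum => y _.
  by apply: ler_bool => h; apply: large_arg_quotient h.
by apply: ler_bool => h; apply: large_arg_quotient h.
Qed.

(** The count at scale 2^k is proportional to 4^k, so after weighting by 4^-k each of the n scales
    contributes equally. [large_differences] with threshold A / 2 bounds the weighted sum by the
    energy. *)
Lemma twisted_energy (n r : nat) :
  (2 ^+ n) ^+ 2 * tau <= 2 * pi -> 16 * B <= A * 2 ^+ r ->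
  n%:R * tau * #|G|%:R ^+ 2 <= 80 * pi * 2 ^+ r / A *
    (\sum_n \sum_m dnsq (W^~ n) e m + \sum_m \sum_n dnsq (V m) e n).
Proof.
move=> nt Br; have pi0 := pi_gt0 R.
pose N1 k := \sum_n \sum_m (A / 2 <= dnsq (W^~ n) (e *+ 2 ^ k) m)%R%:R : R.
pose N2 k := \sum_m \sum_n (A / 2 <= dnsq (V m) (e *+ 2 ^ k) n)%R%:R : R.
have step (k : 'I_n) : tau * #|G|%:R ^+ 2 <= 10 * pi * (4 ^- k * (N1 k + N2 k)).
  have h4 : (2 ^ k)%:R ^+ 2 = 4 ^+ k :> R.
    by rewrite natrX -exprM mulnC exprM -natrX.
  have := @twisted_large_differences (2 ^ k); rewrite h4 -/(N1 k) -/(N2 k).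
  move=> large; rewrite [leRHS]mulrCA ler_pdivlMl ?exprn_gt0 // mulrA large //.
  (* Since k < n there is a spare factor 4, which turns the bound 2 pi into the required pi / 2. *)
  have : (4 : R) ^+ k.+1 <= (2 ^+ n) ^+ 2.
    have -> : (2 ^+ n) ^+ 2 = 4 ^+ n :> R by rewrite expr2 -exprMn -natrM.
    by rewrite ler_weXn2l // ler1n.
  move=> h; have : 4 ^+ k.+1 * tau <= 2 * pi by apply: le_trans nt; rewrite ler_wpM2r.
  by rewrite exprS; lra.
have : \sum_(k < n) tau * #|G|%:R ^+ 2 <= \sum_(k < n) 10 * pi * (4 ^- k * (N1 k + N2 k)).
  by apply: ler_sum.
have -> : n%:R * tau * #|G|%:R ^+ 2 = \sum_(k < n) tau * #|G|%:R ^+ 2.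
  by rewrite sumr_const card_ord -mulrA mulr_natl.
move=> /le_trans; apply.
rewrite -mulr_sumr.
have -> : 80 * pi * 2 ^+ r / A = 10 * pi * (4 * 2 ^+ r / (A / 2)).
  by field; rewrite gt_eqF.
rewrite -[leRHS]mulrA ler_pM2l ?mulr_gt0 // mulrDr.
under eq_bigr => k _ do rewrite mulrDr.
have Br2 : 8 * B <= A / 2 * 2 ^+ r.
  by rewrite [leRHS]mulrAC; move: (A * 2 ^+ r) Br => t; lra.
have A20 : 0 < A / 2 by rewrite divr_gt0.
rewrite big_split /=; apply: lerD; rewrite /N1 /N2.
  under eq_bigr => k _ do rewrite mulr_sumr.
  rewrite exchange_big mulr_sumr; apply: ler_sum => y _.
  apply: large_differences Br2 => // x; by have /andP[] := W_bounds x y.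
under eq_bigr => k _ do rewrite mulr_sumr.
rewrite exchange_big mulr_sumr; apply: ler_sum => y _.
apply: large_differences Br2 => // x; rewrite nsqM g1 mul1r.
by have /andP[] := W_bounds y x.
Qed.

End Twist.
End Vortex.

(** * Roots of unity, characters and their orthogonality *)

Section Characters.
Variable R : realType.

Definition uroot (q : nat) : R[i] := expi (2 * pi / q%:R).

Lemma urootX q n : uroot q ^+ n = expi (2 * pi * n%:R / q%:R).
Proof. by rewrite /uroot -expiMn; congr expi; rewrite -mulr_natl; ring. Qed.

Lemma uroot_expq q : (0 < q)%N -> uroot q ^+ q = 1.
Proof. by move=> q0; rewrite urootX mulfK ?expi_2pi // pnatr_eq0 -lt0n. Qed.

Lemma uroot_neq0 q n : uroot q ^+ n != 0.
Proof. by rewrite urootX expi_neq0. Qed.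

Lemma nsq_uroot q n : nsq (uroot q ^+ n) = 1.
Proof. by rewrite urootX nsq_expi. Qed.

Lemma uroot_mod q p n k : (0 < q)%N -> (q %| p)%N ->
  uroot q ^+ (n %% p * k) = uroot q ^+ (n * k).
Proof.
move=> q0 /dvdnP[c ->]; rewrite ![(_ * k)%N]mulnC !exprM expr_mod //.
by rewrite -exprM mulnA mulnC exprM uroot_expq // expr1n.
Qed.

Lemma uroot_inj q a b : (a < q)%N -> (b < q)%N ->
  uroot q ^+ a = uroot q ^+ b -> a = b.
Proof.
move=> aq bq; rewrite !urootX => h; have q0 : (0 < q%:R :> R).
  by rewrite ltr0n (leq_ltn_trans _ aq).
have pi0 := pi_gt0 R.
have aq' : (a%:R < q%:R :> R) by rewrite ltr_nat.
have bq' : (b%:R < q%:R :> R) by rewrite ltr_nat.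
have a0 : 0 <= a%:R :> R by rewrite ler0n.
have b0 : 0 <= b%:R :> R by rewrite ler0n.
have : 2 * pi * (a%:R / q%:R - b%:R / q%:R) = 0 :> R.
  apply: expi_eq1; first by rewrite mulrBr !mulrA expiD h -expiD subrr expi0.
  rewrite normrM (ger0_norm (_ : 0 <= 2 * pi)) ?mulr_ge0 ?ltW //.
  rewrite gtr_pMr ?mulr_gt0 // -mulrBl ltr_norml ltr_pdivrMr // ltr_pdivlMr //.
  by apply/andP; split; lra.
move/eqP; rewrite !mulf_eq0 pnatr_eq0 /= (gt_eqF pi0) /= -mulrBl mulf_eq0 invr_eq0.
by rewrite (gt_eqF q0) orbF subr_eq0 eqr_nat => /eqP.
Qed.

(** The order q of the root is separate from the ranges p and p' of the coordinates, so that one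
    notion covers the Fourier kernel (q = d) and the Gabor modulations (q = N) on all mixed index
    sets. *)
Definition chi q p p' l (x : 'rV['I_p]_l) (k : 'rV['I_p']_l) : R[i] :=
  uroot q ^+ dotn x k.

Lemma chiE q p p' l (x : 'rV['I_p]_l) (k : 'rV['I_p']_l) :
  chi q x k = \prod_i uroot q ^+ (x ord0 i * k ord0 i).
Proof. by rewrite /chi /dotn expr_sum. Qed.

Lemma chiC q p p' l (x : 'rV['I_p]_l) (k : 'rV['I_p']_l) : chi q x k = chi q k x.
Proof. by rewrite !chiE; apply: eq_bigr => i _; rewrite mulnC. Qed.

Lemma chi_neq0 q p p' l (x : 'rV['I_p]_l) (k : 'rV['I_p']_l) : chi q x k != 0.
Proof. exact: uroot_neq0. Qed.

Lemma nsq_chi q p p' l (x : 'rV['I_p]_l) (k : 'rV['I_p']_l) : nsq (chi q x k) = 1.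
Proof. exact: nsq_uroot. Qed.

Lemma nsq_chiV q p p' l (x : 'rV['I_p]_l) (k : 'rV['I_p']_l) : nsq (chi q x k)^-1 = 1.
Proof. by rewrite /chi urootX -expiN nsq_expi. Qed.

Lemma conj_chi q p p' l (x : 'rV['I_p]_l) (k : 'rV['I_p']_l) :
  (chi q x k)^* = (chi q x k)^-1.
Proof. by rewrite /chi urootX expi_conj. Qed.

Section Additive.
Variables (q p p' l : nat).
Hypotheses (q0 : (0 < q)%N) (qp : (q %| p.+2)%N).
Implicit Types (x y : 'rV['I_p.+2]_l) (k : 'rV['I_p']_l).

Lemma chiDl x y k : chi q (x + y) k = chi q x k * chi q y k.
Proof.
rewrite !chiE -big_split; apply: eq_bigr => i _ /=.
by rewrite mxE /= uroot_mod // mulnDl exprD.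
Qed.

Lemma chi_delta i k : chi q (delta_mx ord0 i : 'rV['I_p.+2]_l) k = uroot q ^+ k ord0 i.
Proof.
rewrite chiE (bigD1 i) //= big1 => [|j ji]; first by rewrite mxE !eqxx mulr1 mul1n.
by rewrite mxE eqxx (negPf ji).
Qed.

End Additive.

(** Translating x by the i-th basis vector multiplies the sum by a ratio [lam] of two distinct q-th
    roots of unity. *)
Lemma chi_sum_eq0 q p p' l (j j' : 'rV['I_p']_l) i : (0 < q)%N -> (q %| p.+2)%N ->
  (j ord0 i %% q != j' ord0 i %% q)%N ->
  \sum_(x : 'rV['I_p.+2]_l) chi q x j * (chi q x j')^-1 = 0.
Proof.
move=> q0 qp ji.
set S := \sum_x _; pose lam := uroot q ^+ j ord0 i / uroot q ^+ j' ord0 i.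
have : S = lam * S.
  rewrite {1}/S -(sum_shift _ (delta_mx ord0 i)) mulr_sumr; apply: eq_bigr => x _.
  by rewrite !chiDl // !chi_delta // invfM /lam; ring.
move/eqP; rewrite -subr_eq0 -{1}[S]mul1r -mulrBl mulf_eq0 subr_eq0 => /orP[|/eqP //].
rewrite eq_sym /lam => /eqP h; move: ji => /eqP[].
apply: (@uroot_inj q); rewrite ?ltn_mod //.
rewrite -[(_ %% q)%N]muln1 -[(j' _ _ %% q)%N]muln1 !uroot_mod // !muln1.
by rewrite -[LHS](divfK (uroot_neq0 q (j' ord0 i))) h mul1r.
Qed.

Lemma chi_orthogonal q p l (j j' : 'rV['I_q]_l) : (q %| p.+2)%N ->
  \sum_(x : 'rV['I_p.+2]_l) chi q x j * (chi q x j')^-1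
    = if j == j' then (#|{: 'rV['I_p.+2]_l}|%:R : R)%:C else 0.
Proof.
move=> qp; have [->|jj'] := eqVneq j j'.
  under eq_bigr => x _ do rewrite mulfV ?chi_neq0 //.
  by rewrite sumr_const rmorph_nat.
have [i ji] : exists i, j ord0 i != j' ord0 i.
  apply/existsP; apply: contra_neqT jj'; rewrite negb_exists => /forallP h.
  by apply/rowP => i; apply/eqP; have := h i; rewrite negbK.
have q0 : (0 < q)%N by exact: leq_ltn_trans (ltn_ord (j ord0 i)).
by apply: (@chi_sum_eq0 _ _ _ _ _ _ i); rewrite ?modn_small ?ltn_ord.
Qed.

(** Stated for any orthogonal family of common squared norm M; it serves the Zak transform, the
    Gabor polynomials and the Fourier transform. *)
Lemma parseval (I X : finType) (phi : I -> X -> R[i]) (M : R) (c : I -> R[i]) :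
  (forall i j, \sum_x phi i x * conjc (phi j x) = if i == j then M%:C else 0) ->
  \sum_x nsq (\sum_i c i * phi i x) = M * \sum_i nsq (c i).
Proof.
move=> orth; apply: complexI; rewrite rmorphM !rmorph_sum /=.
under eq_bigr => x _ do rewrite nsqC rmorph_sum mulr_suml.
rewrite exchange_big mulr_sumr /=; apply: eq_bigr => i _.
under eq_bigr => x _ do rewrite mulr_sumr.
rewrite exchange_big (bigD1 i) //= [X in _ + X]big1 ?addr0 => [|j ji].
  under eq_bigr => x _ do rewrite rmorphM mulrACA.
  by rewrite -mulr_sumr orth eqxx nsqC mulrC.
under eq_bigr => x _ do rewrite rmorphM mulrACA.
by rewrite -mulr_sumr orth eq_sym (negPf ji) mulr0.
Qed.

End Characters.

(** * The finite Zak transform and the Gabor system *)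

Section Zak.
Variables (R : realType) (N' l : nat).
Local Notation N := N'.+2.
Local Notation torus := (torus N l).
Implicit Types (b : ell2 R N l) (m n : torus) (j : 'rV['I_N]_l) (k : 'I_l).

Lemma Zp_cast_sqr : (Zp_trunc (N ^ 2)).+2 = (N ^ 2)%N.
Proof. by rewrite Zp_cast // expnS expn1 ltn_mulr. Qed.

Lemma dvdn_N_sqr : (N %| (Zp_trunc (N ^ 2)).+2)%N.
Proof. by rewrite Zp_cast_sqr dvdn_mulr. Qed.

Lemma dvdn_sqr_sqr : (N ^ 2 %| (Zp_trunc (N ^ 2)).+2)%N.
Proof. by rewrite Zp_cast_sqr. Qed.

Local Hint Resolve dvdn_N_sqr dvdn_sqr_sqr : core.

Lemma card_torus : #|torus|%:R = (N%:R ^+ l) ^+ 2 :> R.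
Proof.
by rewrite card_mx card_ord mul1n Zp_cast_sqr -!natrX -!expnM mulnC.
Qed.

Lemma card_torus_gt0 : 0 < #|torus|%:R :> R.
Proof. by rewrite card_torus !exprn_gt0. Qed.

Lemma ell2_normE b :
  ell2_norm b ^+ 2 = (N%:R ^+ l)^-1 * \sum_m nsq (b m).
Proof.
rewrite sqr_sqrtr // mulr_ge0 ?invr_ge0 ?exprn_ge0 //.
by apply: sumr_ge0 => m _; exact: nsq_ge0.
Qed.

Definition lattice j : torus := \row_(i < l) (N * j ord0 i)%:R.

Lemma val_lattice j i : lattice j ord0 i = (N * j ord0 i)%N :> nat.
Proof.
rewrite mxE val_Zp_nat ?modn_small //.
by rewrite expnS expn1 ltn_pmul2l.
Qed.

(** N times a residue modulo N is a well-defined residue modulo N^2. *)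
Lemma latticeD j j' : lattice (j + j') = lattice j + lattice j'.
Proof.
apply/rowP => i; rewrite !mxE -natrD -mulnDr /= muln_modr mulnn.
by apply: ord_inj; rewrite !val_Zp_nat ?modn_mod // expnS expn1 ltn_mulr.
Qed.

Lemma chi_lattice_N p (x : 'rV['I_p]_l) j : chi R N (lattice j) x = 1.
Proof.
rewrite chiE big1 // => i _.
by rewrite val_lattice -mulnA exprM uroot_expq // expr1n.
Qed.

Lemma uroot_sqr a : uroot R (N ^ 2) ^+ (N * a) = uroot R N ^+ a.
Proof.
rewrite !urootX natrM natrX; congr expi; field.
by rewrite -natrD pnatr_eq0.
Qed.

Lemma chi_lattice_sqr p (x : 'rV['I_p]_l) j :
  chi R (N ^ 2) (lattice j) x = chi R N j x.
Proof.
by rewrite !chiE; apply: eq_bigr => i _; rewrite val_lattice -mulnA uroot_sqr.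
Qed.

(** Only the class of n modulo N matters, yet n runs over the whole torus: both variables then live
    in the same group, where unit steps have a curvature of 2 pi / d. *)
Definition zak (b : torus -> R[i]) m n : R[i] :=
  \sum_j b (m - lattice j) * chi R N j n.

Lemma zak_quasiperiodic (b : torus -> R[i]) m n j :
  zak b (m - lattice j) n = (chi R N j n)^-1 * zak b m n.
Proof.
rewrite {2}/zak -(sum_shift _ j) mulr_sumr; apply: eq_bigr => j' _.
rewrite latticeD chiDl //.
have -> : m - (lattice j' + lattice j) = m - lattice j - lattice j'.
  by rewrite opprD addrA addrAC.
by field; rewrite chi_neq0.
Qed.

Lemma zak_parseval (b : torus -> R[i]) :
  \sum_m \sum_n nsq (zak b m n) = #|torus|%:R * N%:R ^+ l * \sum_m nsq (b m).
Proof.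
have -> : \sum_m \sum_n nsq (zak b m n) =
    \sum_m #|torus|%:R * \sum_j nsq (b (m - lattice j)).
  apply: eq_bigr => m _.
  apply: (parseval (phi := fun j n => chi R N j n)) => j j'.
  under eq_bigr => n _ do rewrite conj_chi !(chiC _ _ _ n).
  exact: chi_orthogonal.
rewrite -mulr_sumr exchange_big -mulrA /=; congr (_ * _).
under eq_bigr => j _ do rewrite (sum_shift (fun x => nsq (b x))).
by rewrite sumr_const card_mx card_ord mul1n -[LHS]mulr_natl natrX.
Qed.

Lemma zak_norm b :
  \sum_m \sum_n nsq (zak b m n) = #|torus|%:R ^+ 2 * ell2_norm b ^+ 2.
Proof.
rewrite zak_parseval ell2_normE mulrA; congr (_ * _).
by rewrite card_torus; field; rewrite expf_neq0 ?pnatr_eq0.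
Qed.

(** The multiplier by which synthesis with coefficients c acts on the Zak side. *)
Definition gabor_poly (c : gabor_index N l -> R[i]) m n : R[i] :=
  \sum_(nm : gabor_index N l) c nm * (chi R N m nm.2 * (chi R N nm.1 n)^-1).

(** A lattice translation multiplies the Zak transform by a character of n, by quasi-periodicity. A
    modulation is trivial on the lattice, so it factors out as a character of m. *)
Lemma zak_gabor b c m n :
  zak (\sum_(nm : gabor_index N l) c nm *: gabor b nm) m n =
    gabor_poly c m n * zak b m n.
Proof.
rewrite /gabor_poly mulr_suml.
have -> : zak (\sum_(nm : gabor_index N l) c nm *: gabor b nm) m n =
  \sum_(nm : gabor_index N l) c nm * zak (gabor b nm) m n.
  rewrite /zak; under eq_bigr => j _ do rewrite sum_ffunE mulr_suml.
  rewrite exchange_big; apply: eq_bigr => nm _; rewrite mulr_sumr.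
  by apply: eq_bigr => j _; rewrite ffunE mulrA.
apply: eq_bigr => nm _; rewrite -!mulrA; congr (_ * _).
rewrite -zak_quasiperiodic /zak mulr_sumr; apply: eq_bigr => j _.
rewrite ffunE mulrA; congr (_ * _).
rewrite [X in b X](_ : _ = m - lattice nm.1 - lattice j); last by rewrite addrAC.
rewrite mulrC; congr (_ * _).
rewrite -urootX -/(chi R N (m - lattice j) nm.2).
by rewrite -[in RHS](subrK (lattice j) m) [RHS]chiDl // chi_lattice_N mulr1.
Qed.

Lemma gabor_poly_parseval c :
  \sum_m \sum_n nsq (gabor_poly c m n) = #|torus|%:R ^+ 2 * \sum_nm nsq (c nm).
Proof.
rewrite pair_big /=.
apply: (parseval (phi := fun (nm : gabor_index N l) (x : torus * torus) =>
   chi R N x.1 nm.2 * (chi R N nm.1 x.2)^-1)) => -[n1 m1] [n2 m2] /=.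
rewrite -(pair_big xpredT xpredT (fun x y => chi R N x m1 * (chi R N n1 y)^-1 *
   conjc (chi R N x m2 * (chi R N n2 y)^-1))) /=.
have -> : \sum_(i : torus) \sum_(j : torus)
    chi R N i m1 * (chi R N n1 j)^-1 * conjc (chi R N i m2 * (chi R N n2 j)^-1) =
   (\sum_(i : torus) chi R N i m1 * (chi R N i m2)^-1) *
   (\sum_(j : torus) chi R N j n2 * (chi R N j n1)^-1).
  rewrite mulr_suml; apply: eq_bigr => i _; rewrite mulr_sumr; apply: eq_bigr => j _.
  rewrite rmorphM /= conjc_inv !conj_chi invrK ![chi R N j _]chiC; ring.
rewrite !chi_orthogonal // xpair_eqE [n2 == n1]eq_sym andbC.
by case: eqP => _ /=; case: eqP => _ /=; rewrite ?mulr0 ?mul0r // -rmorphM -expr2.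
Qed.

Lemma gabor_norm b c :
  #|torus|%:R ^+ 2 * ell2_norm (\sum_(nm : gabor_index N l) c nm *: gabor b nm) ^+ 2 =
  \sum_m \sum_n nsq (gabor_poly c m n) * nsq (zak b m n).
Proof.
rewrite -zak_norm; apply: eq_bigr => m _; apply: eq_bigr => n _.
by rewrite zak_gabor nsqM.
Qed.

(** In n the characters have order N; in m a lattice shift changes only the phase. *)
Lemma nsq_zak_congr b m n m' n' :
  (forall i, m ord0 i = m' ord0 i %[mod N]) ->
  (forall i, n ord0 i = n' ord0 i %[mod N]) ->
  nsq (zak b m n) = nsq (zak b m' n').
Proof.
move=> mm' nn'.
have -> : zak b m n = zak b m n'.
  apply: eq_bigr => j _; congr (_ * _); rewrite !chiE; apply: eq_bigr => i _.
  by rewrite [(_ * n _ _)%N]mulnC -(uroot_mod R _ _ (_ : 0 < N)%N (dvdnn N)) // nn' uroot_mod // mulnC.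
(* Coordinatewise Euclidean division by N: [s] is the quotient and [t] the remainder. *)
pose s (m : torus) : 'rV['I_N]_l := \row_i inord (m ord0 i %/ N).
pose t (m : torus) : torus := \row_i (m ord0 i %% N)%:R.
have st x : x - lattice (s x) = t x.
  apply/eqP; rewrite subr_eq; apply/eqP/rowP => i; rewrite !mxE -natrD inordK.
    by rewrite addnC mulnC -divn_eq natr_Zp.
  by rewrite ltn_divLR // mulnn -{2}Zp_cast_sqr ltn_ord.
have z x : nsq (zak b x n') = nsq (zak b (t x) n').
  by rewrite -st zak_quasiperiodic nsqM nsq_chiV mul1r.
rewrite z [RHS]z; congr (nsq (zak _ _ _)).
by apply/rowP => i; rewrite !mxE mm'.
Qed.

(** The Riesz inequality is tested on a Dirichlet kernel: its polynomial vanishes off the class of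
    (x, y) modulo N, on which |zak b| is constant. *)
Lemma zak_bounds A B b : gabor_riesz_basis A B b ->
  forall m n, A <= nsq (zak b m n) <= B.
Proof.
move=> [_ riesz] x y.
pose c (nm : gabor_index N l) := (chi R N x nm.2)^-1 * chi R N nm.1 y.
have := riesz c; rewrite /= => bounds.
have := gabor_norm b c.
have -> : \sum_m \sum_n nsq (gabor_poly c m n) * nsq (zak b m n) =
   nsq (zak b x y) * \sum_m \sum_n nsq (gabor_poly c m n).
  rewrite mulr_sumr; apply: eq_bigr => m _; rewrite mulr_sumr; apply: eq_bigr => n _.
  rewrite mulrC.
  have [->|P0] := eqVneq (gabor_poly c m n) 0; first by rewrite nsq0 !mulr0.
  have PE : gabor_poly c m n = (\sum_(j : 'rV['I_N]_l) chi R N j m * (chi R N j x)^-1) *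
      (\sum_(j : 'rV['I_N]_l) chi R N j y * (chi R N j n)^-1).
    rewrite mulr_suml; under eq_bigr => i _ do rewrite mulr_sumr.
    rewrite exchange_big pair_big /=; apply: eq_bigr => -[j1 j2] _ /=.
    rewrite /c /= ![chi R N j2 _]chiC; ring.
  congr (_ * _); apply: nsq_zak_congr => i; apply/eqP; apply: contraNT P0 => h.
    by rewrite PE (chi_sum_eq0 _ (i := i)) ?mul0r.
  by rewrite PE mulrC (chi_sum_eq0 _ (i := i)) ?mul0r // eq_sym.
have D0 : (#|torus|%:R : R) ^+ 2 != 0 by rewrite expf_neq0 // lt0r_neq0 // card_torus_gt0.
rewrite gabor_poly_parseval => h; move: h; rewrite [nsq _ * _]mulrCA => /(mulfI D0) h.
move: bounds; rewrite h ![_ * \sum_nm _]mulrC.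
have S0 : 0 < \sum_nm nsq (c nm).
  have -> : \sum_nm nsq (c nm) = #|gabor_index N l|%:R.
    rewrite -sum1_card natr_sum; apply: eq_bigr => nm _.
    by rewrite /c nsqM nsq_chi nsq_chiV mulr1.
  by rewrite ltr0n; apply/card_gt0P; exists (0, 0).
by rewrite !ler_pM2l.
Qed.

Lemma zak_Delta k b m n :
  zak (Delta k b) m n = zak b (m + delta_mx ord0 k) n - zak b m n.
Proof.
rewrite /zak -sumrB; apply: eq_bigr => j _; rewrite ffunE -mulrBl addrAC.
by [].
Qed.

(** The function whose Fourier transform is the k-th difference of that of b. *)
Definition modulate k b : ell2 R N l :=
  [ffun j : torus => b j * ((chi R (N ^ 2) j (delta_mx ord0 k : torus))^-1 - 1)].

(** The character at m splits into its values at m - lattice j and at lattice j; the latter is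
    absorbed by shifting n. *)
Lemma zak_modulate k b m n :
  zak (modulate k b) m n =
   (chi R (N ^ 2) m (delta_mx ord0 k : torus))^-1 * zak b m (n + delta_mx ord0 k)
   - zak b m n.
Proof.
rewrite /zak mulr_sumr -sumrB; apply: eq_bigr => j _; rewrite ffunE.
set e := delta_mx ord0 k : torus.
have -> : chi R N j (n + e) = chi R N j n * chi R (N ^ 2) (lattice j) e.
  by rewrite chi_lattice_sqr !(chiC _ _ j) chiDl.
have -> : chi R (N ^ 2) m e = chi R (N ^ 2) (m - lattice j) e * chi R (N ^ 2) (lattice j) e.
  by rewrite -chiDl ?expn_gt0 // subrK.
by field; rewrite !chi_neq0.
Qed.

(** The difference passes under the Fourier sum to give [modulate], and the normalized transform is
    unitary. *)
Lemma norm_Delta_DFT k b :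
  ell2_norm (Delta k (DFT b)) ^+ 2 = ell2_norm (modulate k b) ^+ 2.
Proof.
rewrite !ell2_normE; congr (_ * _).
set e := delta_mx ord0 k : torus.
have DFTE b' n : DFT b' n = (N%:R ^+ l)^-1 * \sum_j b' j * (chi R (N ^ 2) j n)^-1.
  rewrite ffunE; congr (_ * _); apply: eq_bigr => j _; congr (_ * _).
  by rewrite expiN /chi urootX.
have dE n : Delta k (DFT b) n = (((N%:R ^+ l)^-1 : R)%:C) *
    \sum_j modulate k b j * (chi R (N ^ 2) j n)^-1.
  rewrite ffunE !DFTE -mulrBr fmorphV rmorphXn rmorph_nat; congr (_ * _).
  rewrite -sumrB; apply: eq_bigr => j _; rewrite ffunE.
  rewrite ![chi R _ j (_ : torus)]chiC chiDl ?expn_gt0 // invfM.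
  rewrite -/e; ring.
under eq_bigr => n _ do rewrite dE nsqM nsq_real.
rewrite -mulr_sumr (@parseval R _ _ _ #|torus|%:R) => [|j j'].
  by rewrite mulrA card_torus exprVn mulVf ?mul1r // !expf_neq0 // pnatr_eq0.
under eq_bigr => n _ do rewrite conjc_inv conj_chi invrK mulrC !(chiC _ _ _ n).
rewrite chi_orthogonal; last by [].
by rewrite eq_sym.
Qed.

End Zak.

(** * The logarithmic lower bound *)

Section LowerBound.
Variable R : realType.

Lemma ell2_norm_scale N' l (b : ell2 R N'.+2 l) :
  ell2_norm (N'.+2%:R *: b) ^+ 2 = N'.+2%:R ^+ 2 * ell2_norm b ^+ 2.
Proof.
rewrite !ell2_normE mulrCA; congr (_ * _); rewrite mulr_sumr.
apply: eq_bigr => m _; rewrite ffunE -nsq_real -nsqM rmorph_nat.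
by [].
Qed.

Lemma ell2_norm_scale_add N' l (b b' : ell2 R N'.+2 l) :
  ell2_norm (N'.+2%:R *: b) ^+ 2 + ell2_norm (N'.+2%:R *: b') ^+ 2 =
  N'.+2%:R ^+ 2 * (ell2_norm b ^+ 2 + ell2_norm b' ^+ 2).
Proof.
rewrite mulrDr; congr (_ + _); exact: ell2_norm_scale.
Qed.

(** With n the truncated logarithm, N < 2^(n+1), ln 2 <= 1, and n + 1 <= 2 n because n >= 1. *)
Lemma ln_le_trunc_log (N : nat) : (1 < N)%N ->
  ln (N%:R : R) <= 2 * (trunc_log 2 N)%:R.
Proof.
move=> N1; have n0 : (0 < trunc_log 2 N)%N by rewrite trunc_log_gt0.
have ln2 : ln (2 : R) <= 1.
  by rewrite -[2]/(1 + 1); apply: le_ln1Dx; apply: lt_trans ltr01; exact: ltrN10.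
have NR : (0 : R) < N%:R by rewrite ltr0n (ltn_trans _ N1).
apply: (@le_trans _ _ (ln ((2 ^ (trunc_log 2 N).+1)%:R : R))).
  rewrite ler_ln ?posrE //; last by rewrite ltr0n expn_gt0.
  by rewrite ler_nat ltnW // trunc_log_ltn.
rewrite natrX lnXn // -[leLHS]mulr_natl.
apply: (@le_trans _ _ (trunc_log 2 N).+1%:R).
  by rewrite ler_piMr // ler0n.
rewrite -natrM ler_nat; lia.
Qed.

Lemma exists_pow2_ge (x : R) : exists r, x <= 2 ^+ r.
Proof.
exists (Num.truncn x).+1; apply: ltW; apply: (lt_trans (truncnS_gt x)).
by rewrite -natrX ltr_nat ltn_expl.
Qed.

Lemma lower_bound (A B : R) : 0 < A -> exists2 c : R, 0 < c &
  forall N' l (k : 'I_l) (b : ell2 R N'.+2 l), gabor_riesz_basis A B b ->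
    c * ln (N'.+2%:R : R) <=
      ell2_norm (N'.+2%:R *: Delta k b) ^+ 2 +
      ell2_norm (N'.+2%:R *: Delta k (DFT b)) ^+ 2.
Proof.
move=> A0; have [r hr] := exists_pow2_ge (16 * B / A).
have r0 : (0 : R) < 2 ^+ r by rewrite exprn_gt0.
have c0 : 0 < A / (80 * 2 ^+ r) by rewrite divr_gt0 ?mulr_gt0.
(* With tau = 2 pi / d, [twisted_energy] reads d E >= 2 n A / (80 * 2^r) once pi cancels, and 2 n >=
   ln N. *)
exists (A / (80 * 2 ^+ r)) => // N' l k b riesz.
rewrite (ell2_norm_scale_add (Delta k b) (Delta k (DFT b))).
set N := N'.+2; set e := delta_mx ord0 k : torus N l.
set n := trunc_log 2 N; pose d : R := (N ^ 2)%:R.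
have d0 : 0 < d by rewrite ltr0n expn_gt0.
have pi0 := pi_gt0 R; have D0 := card_torus_gt0 R N' l.
(* The gauge that makes the twisted difference of [zak_modulate] a plain one. *)
pose g (x y : torus N l) := (uroot R (N ^ 2) ^+ (x ord0 k * y ord0 k))^-1.
pose c (x : torus N l) := (chi R (N ^ 2) x e)^-1.
have tau0 : 0 <= 2 * pi / d by rewrite ltW // divr_gt0 // mulr_gt0.
have g1 x y : nsq (g x y) = 1 by rewrite /g urootX -expiN nsq_expi.
have cE x : c x = (uroot R (N ^ 2) ^+ x ord0 k)^-1.
  by rewrite /c chiC chi_delta.
have sqd := dvdn_sqr_sqr N'.
have gS x y : g x (y + e) = g x y * c x.
  rewrite cE /g -invfM -exprD !mxE /= eqxx; congr (_^-1).
  by rewrite [in LHS]mulnC uroot_mod ?expn_gt0 // mulnDl mul1n mulnC.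
have cS x : c (x + e) = c x * expi (- (2 * pi / d)).
  rewrite /c chiDl ?expn_gt0 // invfM expiN; congr (_ / _).
  by rewrite chi_delta mxE !eqxx.
have nd : (2 ^+ n) ^+ 2 * (2 * pi / d) <= 2 * pi.
  rewrite mulrA ler_pdivrMr // mulrC ler_pM2l ?mulr_gt0 // -natrX -natrX ler_nat.
  by rewrite leq_exp2r // trunc_logP.
have Br : 16 * B <= A * 2 ^+ r by rewrite [leRHS]mulrC -ler_pdivrMr.
have := twisted_energy tau0 A0 (zak_bounds riesz) g1 gS cS nd Br.
have -> : \sum_y \sum_x dnsq ((zak b)^~ y) e x =
    #|{: torus N l}|%:R ^+ 2 * ell2_norm (Delta k b) ^+ 2.
  rewrite -zak_norm exchange_big; apply: eq_bigr => x _; apply: eq_bigr => y _.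
  by rewrite zak_Delta.
have -> : \sum_x \sum_y dnsq (fun y => g x y * zak b x y) e y =
    #|{: torus N l}|%:R ^+ 2 * ell2_norm (Delta k (DFT b)) ^+ 2.
  rewrite norm_Delta_DFT -zak_norm; apply: eq_bigr => x _; apply: eq_bigr => y _.
  by rewrite zak_modulate /dnsq gS -mulrA -mulrBr nsqM g1 mul1r.
move: (ell2_norm (Delta k b) ^+ 2) (ell2_norm (Delta k (DFT b)) ^+ 2) => E1 E2.
rewrite -[X in _ <= _ * X -> _]mulrDr.
move: (E1 + E2) => E.
rewrite [leRHS]mulrCA [leRHS]mulrC mulrC; set D := #|_|%:R ^+ 2.
have D20 : 0 < D by rewrite exprn_gt0.
rewrite ![_ * D]mulrC ler_pM2l //; move: D D20 => D _ h.
apply: (@le_trans _ _ (A / (80 * 2 ^+ r) * (2 * n%:R))).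
  by rewrite ler_pM2l // ln_le_trunc_log.
have dE : d = N%:R ^+ 2 by rewrite /d natrX.
rewrite -dE; clearbody d; move: (pi : R) pi0 (2 ^+ r) r0 h => p p0 s s0 h.
have -> : A / (80 * s) * (2 * n%:R) = (A / (80 * p * s) * d) * (n%:R * (2 * p / d)).
  by field; rewrite !gt_eqF.
have -> : d * E = (A / (80 * p * s) * d) * (80 * p * s / A * E).
  by field; rewrite !gt_eqF.
by rewrite ler_pM2l // !mulr_gt0 ?invr_gt0 ?mulr_gt0.
Qed.

End LowerBound.

(** * A unimodular phase with one vortex per cell, in one coordinate *)

Section VortexPhase.
Variables (R : realType) (N' : nat).
Local Notation N := N'.+2.
Local Notation expi := (@expi R).

(* On row y the phase rises linearly from 0 to y / N over a window of width
   N - y, which shrinks to a point at the vortex (0, N). *)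
Definition ramp (x y : nat) : R :=
  if (x <= N - y)%N then y%:R / N%:R * (x%:R / (N - y)%:R) else y%:R / N%:R.

(** The first factor imposes the quasi-periodicity of a Zak transform. Within a cell, the second
    moves from phase 0 to the phase y / N needed at the next cell. *)
Definition vphase (x y : nat) : R[i] :=
  uroot R N ^+ (x %/ N * y) * expi (2 * pi * ramp (x %% N) (y %% N)).

(** Bounds both squared differences up to 4 pi^2: 1 / (N - s) is the scale of the phase change
    inside the ramp window, and 1 / N that outside it. *)
Definition vbound (r s : nat) : R :=
  if (r < N - s)%N then (N - s)%:R ^- 2 else N%:R ^- 2.

Lemma nsq_vphase x y : nsq (vphase x y) = 1.
Proof. by rewrite nsqM nsq_uroot nsq_expi mul1r. Qed.

Lemma uroot_modN a b : uroot R N ^+ (a * (b %% N)) = uroot R N ^+ (a * b).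
Proof. by rewrite ![(a * _)%N]mulnC uroot_mod. Qed.

Lemma vphase_mod x y : vphase x (y %% N) = vphase x y.
Proof. by rewrite /vphase modn_mod uroot_modN. Qed.

Lemma vphase_shift x y j : vphase (x + N * j) y = vphase x y * uroot R N ^+ (j * y).
Proof.
rewrite /vphase addnC [(N * j)%N]mulnC divnMDl // modnMDl mulnDl exprD; ring.
Qed.

Lemma vphase_mod_sqr x y : vphase (x %% N ^ 2) y = vphase x y.
Proof.
rewrite {2}(divn_eq x (N ^ 2)) addnC [(_ * N ^ 2)%N]mulnC -mulnn -mulnA vphase_shift.
by rewrite -mulnA exprM uroot_expq // expr1n mulr1.
Qed.

Lemma ramp0 y : ramp 0 y = 0.
Proof. by rewrite /ramp leq0n mul0r mulr0. Qed.

Lemma ramp_sat x y : (y < N)%N -> (N - y <= x)%N -> ramp x y = y%:R / N%:R.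
Proof.
move=> yN h; rewrite /ramp; case: ifP => // h2.
have -> : x = (N - y)%N by apply/eqP; rewrite eqn_leq h h2.
by rewrite divff ?mulr1 // pnatr_eq0 subn_eq0 -ltnNge.
Qed.

Lemma ramp_lin x y : (y < N)%N -> (x <= N - y)%N ->
  ramp x y = x%:R / (N - y)%:R - x%:R / N%:R.
Proof.
move=> yN h; rewrite /ramp h.
have t0 : (N - y)%:R != 0 :> R by rewrite pnatr_eq0 subn_eq0 -ltnNge.
have N0 : N%:R != 0 :> R by rewrite pnatr_eq0.
have -> : y%:R = N%:R - (N - y)%:R :> R by rewrite -natrB ?leq_subr // subKn // ltnW.
by move: t0 N0; move: (N%:R) ((N - y)%:R) => a b a0 b0; field; rewrite a0 b0.
Qed.

Lemma nsq_phase_le (z : R[i]) s t (c : R) : nsq z = 1 -> `|s - t| <= c ->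
  nsq (z * expi (2 * pi * s) - z * expi (2 * pi * t)) <= 4 * pi ^+ 2 * c ^+ 2.
Proof.
move=> z1 h; rewrite -mulrBr nsqM z1 mul1r; apply: le_trans (nsq_expiB _ _) _.
rewrite -mulrBr exprMn.
have -> : (2 * pi) ^+ 2 = 4 * pi ^+ 2 :> R by ring.
rewrite ler_pM2l ?mulr_gt0 ?exprn_gt0 ?pi_gt0 //.
rewrite -(real_normK (num_real (s - t))) lerXn2r // nnegrE //.
exact: le_trans h.
Qed.

Lemma vphaseSl x y : nsq (vphase x.+1 y - vphase x y) <=
  4 * pi ^+ 2 * vbound (x %% N) (y %% N).
Proof.
set r := (x %% N)%N; set s := (y %% N)%N.
have rN : (r < N)%N by rewrite ltn_mod.
have sN : (s < N)%N by rewrite ltn_mod.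
(* This holds even when r + 1 = N: the jump of the first factor at the next cell equals the
   saturated phase s / N. *)
have -> : vphase x.+1 y = uroot R N ^+ (x %/ N * y) * expi (2 * pi * ramp r.+1 s).
  have xE : x.+1 = (x %/ N * N + r.+1)%N by rewrite addnS -divn_eq.
  rewrite /vphase -/s {1 2}xE divnMDl // modnMDl.
  have [rS|rS] := ltnP r.+1 N; first by rewrite (divn_small rS) modn_small // addn0.
  have -> : r.+1 = N by apply/eqP; rewrite eqn_leq rS andbT.
  rewrite divnn modnn /= ramp0 mulr0 expi0 mulr1 addn1 mulSn addnC exprD.
  congr (_ * _); rewrite ramp_sat ?leq_subr // mulrA -urootX.
  by rewrite -[s]mul1n uroot_modN mul1n.
rewrite /vphase -/r -/s.
have t0 : (0 : R) < (N - s)%:R by rewrite ltr0n subn_gt0.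
have -> : vbound r s = (if (r < N - s)%N then (N - s)%:R^-1 else N%:R^-1) ^+ 2.
  by rewrite /vbound; case: ifP; rewrite exprVn.
apply: nsq_phase_le; first exact: nsq_uroot.
case: ltnP => h; last by rewrite !ramp_sat ?subrr ?normr0 ?invr_ge0 // ltnW.
rewrite !ramp_lin // 1?ltnW // -[r.+1%:R]natr1.
have Nt : N%:R^-1 <= (N - s)%:R^-1 :> R by rewrite lef_pV2 ?posrE // ler_nat leq_subr.
have N0 : (0 : R) <= N%:R^-1 by rewrite invr_ge0.
move: Nt N0; move: (_^-1) ((N - s)%:R^-1) (r%:R : R) => a c u ca a0.
have -> : (u + 1) * c - (u + 1) * a - (u * c - u * a) = c - a by ring.
by rewrite ler_norml; apply/andP; split; lra.
Qed.

(** The twist cancels the growth of the first factor in y up to a phase r / d <= 1 / N, which leaves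
    the change of the ramp between adjacent rows. *)
Lemma vphaseSr x y :
  nsq ((uroot R (N ^ 2) ^+ x)^-1 * vphase x y.+1 - vphase x y) <=
  4 * pi ^+ 2 * vbound (x %% N) (y %% N).
Proof.
set r := (x %% N)%N; set s := (y %% N)%N.
have rN : (r < N)%N by rewrite ltn_mod.
have sN : (s < N)%N by rewrite ltn_mod.
(* At the wrap-around s + 1 = N the ramp restarts at 0. For r > 0 the equivalent phase 1 is taken,
   close to the values on row s; at r = 0 both rows have phase 0. *)
pose h' := if (s.+1 < N)%N then ramp r s.+1 else (0 < r)%:R.
have -> : (uroot R (N ^ 2) ^+ x)^-1 * vphase x y.+1 =
   uroot R N ^+ (x %/ N * y) * expi (2 * pi * (h' - r%:R / (N ^ 2)%:R)).
  have -> : uroot R (N ^ 2) ^+ x = uroot R N ^+ (x %/ N) * expi (2 * pi * (r%:R / (N ^ 2)%:R)).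
    by rewrite {1}(divn_eq x N) -/r exprD mulnC uroot_sqr [in RHS]mulrA -urootX.
  have -> : vphase x y.+1 = uroot R N ^+ (x %/ N * y) * uroot R N ^+ (x %/ N) * expi (2 * pi * h').
    rewrite /vphase -/r -exprD -mulnSr; congr (_ * _).
    have -> : (y.+1 %% N = s.+1 %% N)%N by rewrite -[y.+1]addn1 -modnDml addn1.
    rewrite /h'.
    have [sS|sS] := ltnP s.+1 N; first by rewrite modn_small.
    have -> : s.+1 = N by apply/eqP; rewrite eqn_leq sS andbT.
    rewrite modnn /ramp !mul0r if_same mulr0 expi0.
    by case: (0 < r)%N; rewrite ?mulr0 ?expi0 // mulr1 expi_2pi.
  rewrite mulrBr expiD expiN; field.
  by rewrite expi_neq0 uroot_neq0.
rewrite /vphase -/r -/s.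
have t0 : (0 : R) < (N - s)%:R by rewrite ltr0n subn_gt0.
have -> : vbound r s = (if (r < N - s)%N then (N - s)%:R^-1 else N%:R^-1) ^+ 2.
  by rewrite /vbound; case: ifP; rewrite exprVn.
apply: nsq_phase_le; first exact: nsq_uroot.
have NR0 : (0 : R) < N%:R by [].
have rd : (0 <= r%:R / (N ^ 2)%:R :> R) && (r%:R / (N ^ 2)%:R <= N%:R^-1 :> R).
  apply/andP; split; first by rewrite divr_ge0.
  rewrite natrX ler_pdivrMr ?exprn_gt0 // expr2 mulrA mulVf ?mul1r ?gt_eqF //.
  by rewrite ler_nat ltnW.
have Nt : N%:R^-1 <= (N - s)%:R^-1 :> R by rewrite lef_pV2 ?posrE // ler_nat leq_subr.
(* The ramp increment and the residual twist both lie in [0, c], so subtracting them costs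
   nothing. *)
have bnd (a c : R) : 0 <= a <= c -> N%:R^-1 <= c -> `|a - r%:R / (N ^ 2)%:R| <= c.
  move: rd; move: (r%:R / _) (N%:R^-1) => u v /andP[? ?] /andP[? ?] ?.
  by rewrite ler_norml; apply/andP; split; lra.
rewrite addrAC; case: ltnP => h.
  apply: bnd => //; rewrite /h'; case: ltnP => hs; last first.
    have r0 : r = 0%N by lia.
    by rewrite r0 ramp0 subr0 lexx invr_ge0 ler0n.
  rewrite !ramp_lin //; [|lia..].
  have tE : (N - s)%:R = (N - s.+1)%:R + 1 :> R by rewrite natr1; congr _%:R; lia.
  have rt : r%:R <= (N - s.+1)%:R :> R by rewrite ler_nat; lia.
  have t1 : (0 : R) < (N - s.+1)%:R by rewrite ltr0n; lia.
  have r0 : (0 : R) <= r%:R by rewrite ler0n.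
  rewrite tE; move: rt t1 r0; move: (r%:R) ((N - s.+1)%:R) (N%:R) => a t M rt t1 r0.
  have -> : a / t - a / M - (a / (t + 1) - a / M) = a / t * (t + 1)^-1.
    have -> : a / t - a / M - (a / (t + 1) - a / M) = a / t - a / (t + 1) by ring.
    by field; rewrite !gt_eqF // addr_gt0.
  have t1' : 0 < t + 1 by rewrite addr_gt0.
  rewrite mulr_ge0 ?divr_ge0 ?invr_ge0 ?(ltW t1) ?(ltW t1') //=.
  by rewrite ler_piMl ?invr_ge0 ?(ltW t1') // ler_pdivrMr // mul1r.
apply: bnd => //; rewrite (ramp_sat sN h) /h'; case: ltnP => hs.
  rewrite ramp_sat //; last by lia.
  by rewrite -mulrBl -natr1 addrAC subrr add0r mul1r lexx invr_ge0 ler0n.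
have -> : (0 < r)%N by lia.
have -> : s%:R = N%:R - 1 :> R by rewrite -(natrB _ (_ : 1 <= N)%N) //; congr _%:R; lia.
rewrite mulrBl divff ?gt_eqF // mul1r opprB addrCA subrr addr0 lexx invr_ge0 ler0n.
by [].
Qed.

Lemma harmonic_le n : \sum_(1 <= t < n.+2) t%:R^-1 <= 1 + ln (n.+1%:R : R).
Proof.
elim: n => [|n IH]; first by rewrite big_nat1 ln1 invr1 addr0.
rewrite big_nat_recr //=; apply: (le_trans (lerD IH (lexx _))).
rewrite -addrA lerD2l -lerBrDl.
have n0 : (0 : R) < n.+2%:R by [].
have n1 : (0 : R) < n.+1%:R by [].
have : ln (1 - n.+2%:R^-1) <= - n.+2%:R^-1 :> R.
  by apply: le_ln1Dx; rewrite ltrN2 invf_lt1 // ltr1n.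
have -> : 1 - n.+2%:R^-1 = n.+1%:R / n.+2%:R :> R.
  have : n.+2%:R = n.+1%:R + 1 :> R by rewrite natr1.
  move: n0; move: (n.+2%:R) (n.+1%:R) => b a b0 ba.
  by apply: (mulIf (lt0r_neq0 b0)); rewrite mulrBl !mulfVK ?gt_eqF // mulVf ?gt_eqF // ba; ring.
by rewrite ln_div ?posrE // -opprB lerN2.
Qed.

(** In row s the N - s window points give 1 / (N - s) and the others at most 1 / N. The total is at
    most 2 + ln N, and ln N >= ln 2 >= 1/2 absorbs the 2. *)
Lemma sum_vbound : \sum_(r < N) \sum_(s < N) vbound r s <= 5 * ln (N%:R : R).
Proof.
rewrite exchange_big /=.
have NR0 : (0 : R) < N%:R by [].
apply: (@le_trans _ _ (\sum_(s < N) ((N - s)%:R^-1 + N%:R^-1))).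
  apply: ler_sum => s _.
  have t0 : (0 : R) < (N - s)%:R by rewrite ltr0n subn_gt0.
  rewrite (bigID (fun r : 'I_N => (r < N - s)%N)) /=; apply: lerD.
    rewrite (eq_bigr (fun=> (N - s)%:R ^- 2)) => [|r]; last by rewrite /vbound => ->.
    rewrite (big_ord_narrow (leq_subr s N)) sumr_const card_ord -[leLHS]mulr_natr.
    by rewrite expr2 invfM -mulrA mulVf ?mulr1 // gt_eqF.
  rewrite (eq_bigr (fun=> N%:R ^- 2)) => [|r /negPf]; last by rewrite /vbound => ->.
  rewrite sumr_const -[leLHS]mulr_natr expr2 invfM -mulrA ler_piMr ?invr_ge0 //.
  rewrite ler_pdivrMl // mulr1 ler_nat -[leqRHS]card_ord; exact: max_card.
rewrite big_split /= sumr_const card_ord -[X in _ + X]mulr_natr mulVf ?gt_eqF //.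
have -> : \sum_(s < N) (N - s)%:R^-1 = \sum_(1 <= t < N.+1) t%:R^-1 :> R.
  rewrite big_add1 /= big_mkord (reindex_inj rev_ord_inj) /=.
  by apply: eq_bigr => s _; congr _^-1; congr _%:R; have := ltn_ord s; lia.
have := harmonic_le N'.+1.
have ln2 : 1 / 2 <= ln (2 : R).
  have : ln (1 - 2^-1) <= - 2^-1 :> R by apply: le_ln1Dx; rewrite ltrN2 invf_lt1 // ltr1n.
  have -> : 1 - 2^-1 = 2^-1 :> R by field.
  by rewrite lnV ?posrE //; lra.
have : ln (2 : R) <= ln N%:R by rewrite ler_ln ?posrE // ler_nat.
lra.
Qed.

Lemma sum_ord_modn (F : nat -> R) M : \sum_(x < N * M) F (x %% N)%N = M%:R * \sum_(r < N) F r.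
Proof.
rewrite -(big_mkord xpredT (fun x => F (x %% N)%N)).
elim: M => [|M IH]; first by rewrite muln0 big_geq // mul0r.
rewrite mulnS (big_cat_nat _ (n := N)) //= ?leq_addr //.
have -> : \sum_(N <= x < N + N * M) F (x %% N)%N = \sum_(0 <= x < N * M) F (x %% N)%N.
  rewrite -{1}[N]add0n big_addn addKn.
  by apply: eq_bigr => x _; rewrite modnDr.
rewrite IH -[M.+1%:R]natr1 mulrDl mul1r addrC; congr (_ + _).
by rewrite big_mkord; apply: eq_bigr => x _; rewrite modn_small.
Qed.

End VortexPhase.

(** * The generator with small energy *)

Section Construction.
Variables (R : realType) (N' l : nat) (A : R).
Hypothesis A0 : 0 < A.
Local Notation N := N'.+2.
Local Notation torus := (torus N l).
Implicit Types (m n : torus) (j : 'rV['I_N]_l) (k : 'I_l).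

Definition vtensor p p' (x : 'rV['I_p]_l) (y : 'rV['I_p']_l) : R[i] :=
  \prod_i vphase R N' (x ord0 i) (y ord0 i).

Lemma nsq_prod (I : finType) (P : pred I) (F : I -> R[i]) :
  (forall i, nsq (F i) = 1) -> nsq (\prod_(i | P i) F i) = 1.
Proof.
move=> F1; elim/big_ind: _ => [|x y x1 y1|i _]; first exact: nsq1.
  by rewrite nsqM x1 y1 mulr1.
exact: F1.
Qed.

Lemma val_torusD m m' i :
  (m + m') ord0 i = ((m ord0 i + m' ord0 i) %% N ^ 2)%N :> nat.
Proof.
have key a b : ((a + b) %% (Zp_trunc (N ^ 2)).+2 = (a + b) %% N ^ 2)%N.
  by rewrite Zp_cast_sqr.
by rewrite mxE; exact: key.
Qed.

Lemma vtensor_lattice p' m j (y : 'rV['I_p']_l) :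
  vtensor (m + lattice j) y = vtensor m y * chi R N j y.
Proof.
rewrite chiE -big_split; apply: eq_bigr => i _ /=.
by rewrite val_torusD val_lattice vphase_mod_sqr vphase_shift.
Qed.

(** The inverse Zak transform of sqrt A times [vtensor]: an average over the frequencies modulo
    N. *)
Definition generator : ell2 R N l :=
  [ffun m : torus => (Num.sqrt A / N%:R ^+ l)%:C * \sum_(y : 'rV['I_N]_l) vtensor m y].

Lemma zak_generator m n : zak generator m n = (Num.sqrt A)%:C * vtensor m n.
Proof.
pose red : 'rV['I_N]_l := \row_i inord (n ord0 i %% N).
have redE i : red ord0 i = (n ord0 i %% N)%N :> nat by rewrite mxE inordK // ltn_mod.
have -> : vtensor m n = vtensor m red.
  by apply: eq_bigr => i _; rewrite redE vphase_mod.
have chi_red j : chi R N j n = chi R N j red.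
  by rewrite !chiE; apply: eq_bigr => i _; rewrite redE uroot_modN.
rewrite /zak.
have -> : \sum_j generator (m - lattice j) * chi R N j n =
  (Num.sqrt A / N%:R ^+ l)%:C * \sum_(y : 'rV['I_N]_l) vtensor m y *
    \sum_(j : 'rV['I_N]_l) chi R N j red * (chi R N j y)^-1.
  under eq_bigr => j _ do rewrite ffunE chi_red -mulrA mulr_suml.
  rewrite -mulr_sumr exchange_big /=; congr (_ * _); apply: eq_bigr => y _.
  rewrite mulr_sumr; apply: eq_bigr => j _.
  rewrite -[in RHS](subrK (lattice j) m) vtensor_lattice.
  by field; rewrite chi_neq0.
under eq_bigr => y _ do rewrite chi_orthogonal //.
rewrite (bigD1 red) //= eqxx big1 ?addr0 => [|y /negPf yr]; last first.
  by rewrite eq_sym yr mulr0.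
rewrite mulrCA -rmorphM /= mulrC; congr (_%:C * _).
by rewrite card_mx card_ord mul1n natrX divfK // expf_neq0 // pnatr_eq0.
Qed.

Lemma nsq_zak_generator m n : nsq (zak generator m n) = A.
Proof.
rewrite zak_generator nsqM nsq_real sqr_sqrtr ?ltW // nsq_prod ?mulr1 // => i.
exact: nsq_vphase.
Qed.

Lemma generator_tight (c : gabor_index N l -> R[i]) :
  ell2_norm (\sum_(nm : gabor_index N l) c nm *: gabor generator nm) ^+ 2 =
  A * \sum_nm nsq (c nm).
Proof.
have D0 : (#|torus|%:R : R) ^+ 2 != 0.
  by rewrite expf_neq0 // lt0r_neq0 // card_torus_gt0.
apply: (mulfI D0); rewrite gabor_norm [RHS]mulrCA -gabor_poly_parseval mulr_sumr.
apply: eq_bigr => m _; rewrite mulr_sumr; apply: eq_bigr => n _.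
by rewrite nsq_zak_generator mulrC.
Qed.

(** Tightness with A > 0 gives freeness, and the N^(2l) elements match the dimension d^l. *)
Lemma generator_basis : basis_of fullv (codom (gabor generator)).
Proof.
have -> : codom (gabor generator) = codom_tuple (gabor generator) by [].
rewrite basisEfree subvf size_tuple /=; apply/andP; split.
  apply/freeP => c.
  have nthE (i : 'I_#|gabor_index N l|) :
      (codom_tuple (gabor generator))`_i = gabor generator (enum_val i).
    by rewrite /= nth_codom.
  under eq_bigr => i _ do rewrite nthE.
  move=> c0 i.
  pose c' nm := c (enum_rank nm).
  have := generator_tight c'.
  have -> : \sum_(nm : gabor_index N l) c' nm *: gabor generator nm = 0.
    rewrite -[RHS]c0 [LHS](reindex_onto enum_val enum_rank) /=; last first.
      by move=> ? _; rewrite enum_rankK.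
    by apply: eq_big => j; rewrite ?enum_valK ?eqxx // /c' enum_valK.
  have -> : ell2_norm (0 : ell2 R N l) ^+ 2 = 0.
    by rewrite ell2_normE big1 ?mulr0 // => m _; rewrite ffunE nsq0.
  move/eqP; rewrite eq_sym mulf_eq0 gt_eqF //= psumr_eq0 => [|nm _]; last exact: nsq_ge0.
  move=> /allP/(_ (enum_val i)); rewrite mem_index_enum => /(_ isT) /=.
  rewrite /c' enum_valK => h; apply/eqP; apply: contraTT h => ci.
  by rewrite gt_eqF // nsq_gt0.
rewrite dimvf -[X in (X <= _)%N]/(#|torus| * 1)%N muln1 card_prod !card_mx !card_ord.
by rewrite Zp_cast_sqr !mul1n -expnMn mulnn.
Qed.

Lemma generator_riesz B : A <= B -> gabor_riesz_basis A B generator.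
Proof.
move=> AB; split; first exact: generator_basis.
move=> c; rewrite /= generator_tight lexx andTb.
by rewrite ler_wpM2r // sumr_ge0 // => nm _; exact: nsq_ge0.
Qed.

(** Averaging over the N^2 translations of the k-th coordinate avoids splitting the torus as a
    product. *)
Lemma sum_torus_coord (F : 'Z_(N ^ 2) -> R) k :
  (N%:R ^+ 2) * \sum_(m : torus) F (m ord0 k) = #|torus|%:R * \sum_x F x.
Proof.
have -> : N%:R ^+ 2 * \sum_(m : torus) F (m ord0 k) =
    \sum_(t : 'Z_(N ^ 2)) \sum_(m : torus) F (m ord0 k + t).
  have -> : \sum_(t : 'Z_(N ^ 2)) \sum_(m : torus) F (m ord0 k + t) =
      \sum_(t : 'Z_(N ^ 2)) \sum_(m : torus) F (m ord0 k).
    apply: eq_bigr => t _; rewrite -[RHS](sum_shift _ (t *: delta_mx ord0 k)).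
    by apply: eq_bigr => m _; rewrite !mxE !eqxx mulr1.
  rewrite sumr_const card_ord; move: (\sum_(m : torus) _) => S.
  by rewrite Zp_cast_sqr -[RHS]mulr_natl natrX.
rewrite exchange_big /=.
under eq_bigr => m _ do [under eq_bigr => t _ do rewrite addrC; rewrite (sum_shift F)].
by rewrite sumr_const -[LHS]mulr_natl.
Qed.

(** The other coordinates contribute a common unimodular factor, so the energy in direction k is
    one-dimensional whatever l is. *)
Lemma vtensor_diff k (a : R[i]) (x x' y y' : torus) : nsq a = 1 ->
  (forall i, i != k -> x ord0 i = x' ord0 i) ->
  (forall i, i != k -> y ord0 i = y' ord0 i) ->
  nsq (a * vtensor x y - vtensor x' y') =
  nsq (a * vphase R N' (x ord0 k) (y ord0 k) - vphase R N' (x' ord0 k) (y' ord0 k)).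
Proof.
move=> a1 xx yy; rewrite /vtensor (bigD1 k) //= [in X in _ - X](bigD1 k) //=.
have -> : \prod_(i | i != k) vphase R N' (x ord0 i) (y ord0 i) =
   \prod_(i | i != k) vphase R N' (x' ord0 i) (y' ord0 i).
  by apply: eq_bigr => i ik; rewrite xx // yy.
rewrite mulrA -mulrBl nsqM nsq_prod ?mulr1 // => i; exact: nsq_vphase.
Qed.

Lemma torus_delta_neq m k i : i != k -> (m + delta_mx ord0 k) ord0 i = m ord0 i.
Proof. by move=> ik; rewrite !mxE eqxx (negPf ik) addr0. Qed.

Lemma val_torus_delta m k :
  (m + delta_mx ord0 k) ord0 k = ((m ord0 k).+1 %% N ^ 2)%N :> nat.
Proof. by rewrite val_torusD mxE !eqxx addn1. Qed.

Lemma sum_vbound_torus k :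
  N%:R ^+ 2 * \sum_(m : torus) \sum_(n : torus) vbound R N' (m ord0 k %% N) (n ord0 k %% N)
    <= #|torus|%:R ^+ 2 * (5 * ln (N%:R : R)).
Proof.
pose F (x y : 'Z_(N ^ 2)) := vbound R N' (x %% N) (y %% N).
have N0 : (N%:R : R) ^+ 2 != 0 by rewrite expf_neq0 // pnatr_eq0.
have modE (f : nat -> R) : \sum_(x : 'Z_(N ^ 2)) f (x %% N)%N = N%:R * \sum_(r < N) f r.
  by rewrite -sum_ord_modn Zp_cast_sqr -mulnn.
have -> : N%:R ^+ 2 * \sum_(m : torus) \sum_(n : torus) F (m ord0 k) (n ord0 k) =
   #|torus|%:R ^+ 2 * \sum_(r < N) \sum_(s < N) vbound R N' r s.
  apply: (mulfI N0).
  transitivity (N%:R ^+ 2 * (#|torus|%:R * \sum_(m : torus) \sum_y F (m ord0 k) y)).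
    congr (_ * _); rewrite !mulr_sumr; apply: eq_bigr => m _.
    by rewrite (sum_torus_coord (F (m ord0 k))).
  rewrite mulrCA (sum_torus_coord (fun x => \sum_y F x y)) mulrA -expr2 mulrCA.
  congr (_ * _).
  under eq_bigr => x _ do rewrite /F (modE (vbound R N' (x %% N))).
  rewrite (modE (fun r => N%:R * \sum_(s < N) vbound R N' r s)).
  by rewrite -mulr_sumr mulrA.
by rewrite ler_wpM2l ?exprn_ge0 // sum_vbound.
Qed.

(** The constant is 2 * 4 * 5: two energies, the 4 pi^2 of the phase estimates, and the 5 of
    [sum_vbound]. *)
Lemma generator_energy k :
  ell2_norm (N%:R *: Delta k generator) ^+ 2 +
  ell2_norm (N%:R *: Delta k (DFT generator)) ^+ 2 <=
  40 * pi ^+ 2 * A * ln (N%:R : R).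
Proof.
rewrite (ell2_norm_scale_add (Delta k generator) (Delta k (DFT generator))).
have D0 : (0 : R) < #|torus|%:R ^+ 2 by rewrite exprn_gt0 // card_torus_gt0.
pose S : R := \sum_(m : torus) \sum_(n : torus) vbound R N' (m ord0 k %% N) (n ord0 k %% N).
have sA : (Num.sqrt A) ^+ 2 = A by rewrite sqr_sqrtr // ltW.
have h1 : #|torus|%:R ^+ 2 * ell2_norm (Delta k generator) ^+ 2 <= A * (4 * pi ^+ 2) * S.
  rewrite -zak_norm mulr_sumr; apply: ler_sum => m _; rewrite mulr_sumr; apply: ler_sum => n _.
  rewrite zak_Delta !zak_generator -mulrBr nsqM nsq_real sA -mulrA ler_pM2l //.
  rewrite -[X in X - _]mul1r (@vtensor_diff k) ?nsq1 ?mul1r => [|//|i|//].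
    by rewrite val_torus_delta vphase_mod_sqr; exact: vphaseSl.
  exact: torus_delta_neq.
have h2 : #|torus|%:R ^+ 2 * ell2_norm (Delta k (DFT generator)) ^+ 2 <= A * (4 * pi ^+ 2) * S.
  rewrite norm_Delta_DFT -zak_norm mulr_sumr; apply: ler_sum => m _.
  rewrite mulr_sumr; apply: ler_sum => n _.
  rewrite zak_modulate !zak_generator mulrCA -mulrBr nsqM nsq_real sA -mulrA ler_pM2l //.
  rewrite (@vtensor_diff k) ?nsq_chiV => [|//|//|i]; last exact: torus_delta_neq.
  rewrite val_torus_delta chiC chi_delta.
  (* Reducing n + 1 modulo N^2 is harmless, since [vphase] depends on its second argument only
     modulo N. *)
  rewrite -(vphase_mod R N' _ (_ %% _)) modn_dvdm ?dvdn_mulr // vphase_mod.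
  exact: vphaseSr.
have h3 := sum_vbound_torus k; rewrite -/S in h3.
rewrite -(ler_pM2l D0) mulrCA.
have Ap : 0 <= A * (4 * pi ^+ 2) by rewrite !mulr_ge0 ?exprn_ge0 ?pi_ge0 // ltW.
have N20 : (0 : R) <= N%:R ^+ 2 by rewrite exprn_ge0.
apply: (@le_trans _ _ (N%:R ^+ 2 * (2 * (A * (4 * pi ^+ 2) * S)))).
  by rewrite ler_wpM2l // mulrDr; lra.
have := ler_wpM2l Ap h3.
move: (N%:R ^+ 2 : R) (#|torus|%:R ^+ 2 : R) (ln _) (pi ^+ 2 : R) => a D L p.
have -> : a * (2 * (A * (4 * p) * S)) = 2 * (A * (4 * p) * (a * S)) by ring.
have -> : D * (40 * p * A * L) = 2 * (A * (4 * p) * (D * (5 * L))) by ring.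
by move=> h; rewrite ler_pM2l.
Qed.

End Construction.

Theorem theorem1p6 (R : realType) (A B : R) (A_gt0 : 0 < A) (leAB : A <= B) :
  exists c C : R, 0 < c /\
    forall (l N : nat) (k : 'I_l), (1 <= l)%N -> (2 <= N)%N ->
      (forall b : ell2 R N l, gabor_riesz_basis A B b ->
         c * ln (N%:R : R) <=
           ell2_norm (N%:R *: Delta k b) ^+ 2 +
           ell2_norm (N%:R *: Delta k (DFT b)) ^+ 2) /\
      (exists b : ell2 R N l, gabor_riesz_basis A B b /\
         ell2_norm (N%:R *: Delta k b) ^+ 2 +
         ell2_norm (N%:R *: Delta k (DFT b)) ^+ 2 <= C * ln (N%:R : R)).
Proof.
have [c c_gt0 lower] := lower_bound B A_gt0.
exists c, (40 * pi ^+ 2 * A); split => // l [|[|N']] // k _ _; split.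
  exact: lower.
exists (generator N' l A); split; first exact: generator_riesz.
exact: generator_energy.
Qed.
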